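(* Let $(G,K)=(\mathrm{GL}_{2n}(\mathbb C),\mathrm{Sp}_{2n}(\mathbb C))$ (symmetric pair of type AII), let $P=P_S\subset G$ and $Q=Q_T\subset K$ be parabolic subgroups with $S\subset\{\alpha_1,\dots,\alpha_{2n-1}\}$, $T\subset\{\beta_1,\dots,\beta_n\}$ in the notation of the context. The double flag variety $K/Q\times G/P$ has finitely many $K$-orbits (for the diagonal action) in each of the following cases: (a) $S=\{\alpha_i\}$ for any $i$, and $T$ is any subset; (b) $S=\{\alpha_i,\alpha_j\}$ for any $i,j$, and $T=\{\beta_n\}$.
   Context: $\mathrm{Sp}_{2n}\subset\mathrm{GL}_{2n}$ is the isometry group of a symplectic form on $\mathbb C^{2n}$. For $S=\{\alpha_{i_1},\dots,\alpha_{i_k}\}$ with $i_1<\dots<i_k$, $P_S\subset\mathrm{GL}_{2n}$ is the stabilizer of a flag of subspaces of dimensions $i_1<\dots<i_k$. For $T=\{\beta_{j_1},\dots,\beta_{j_l}\}$ with $j_1<\dots<j_l$, $Q_T\subset\mathrm{Sp}_{2n}$ is the stabilizer of a flag of isotropic subspaces of dimensions $j_1<\dots<j_l\le n$ (so $Q_{\{\beta_n\}}$ is the stabilizer of a Lagrangian subspace). Equivalently, $S$ (resp. $T$) is the complement $\Pi\setminus J$ of the set of simple roots generating the Levi part, with standard numbering of the Dynkin diagrams $A_{2n-1}$, $C_n$ ($\beta_n$ the long root). *)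

(* Defs.v *)
From HB Require Import structures.
From mathcomp Require Import all_boot all_order all_algebra.
From mathcomp Require Import boolp classical_sets cardinality reals.
From mathcomp Require Import complex.

Set Implicit Arguments.
Unset Strict Implicit.
Unset Printing Implicit Defensive.

Import GRing.Theory.
Local Open Scope classical_set_scope.
Local Open Scope ring_scope.

Section Groups.
Variables (F : fieldType) (m : nat).
Implicit Types (g : 'M[F]_m) (H : set 'M[F]_m) (D : set nat).

Definition GL : set 'M[F]_m := [set g | g \in unitmx].

Definition Sp (w : {skew_symmetric 'cV[F]_m}) : set 'M[F]_m :=
  [set g | g \in unitmx /\ isometry w w (mulmx g)].

(* A flag is indexed by the dimensions of its members: [E i] is the member of
   dimension [i], and it is meaningful only for [i] in the set [D]. A set of
   simple roots is represented in the same way by the set of their indices. *)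
Definition is_flag D (E : nat -> {vspace 'cV[F]_m}) : Prop :=
  (forall i, D i -> \dim (E i) = i) /\
  (forall i j, D i -> D j -> (i <= j)%N -> (E i <= E j)%VS).

Definition is_isotropic_flag (w : {skew_symmetric 'cV[F]_m}) D
    (E : nat -> {vspace 'cV[F]_m}) : Prop :=
  is_flag D E /\ (forall j, D j -> (E j <= orthov w (E j))%VS).

Definition flag_stabilizer H D (E : nat -> {vspace 'cV[F]_m}) : set 'M[F]_m :=
  [set g | H g /\ forall i, D i -> (linfun (mulmx g) @: E i)%VS = E i].

Definition left_coset g H : set 'M[F]_m := [set g *m h | h in H].

Definition coset_space H H' : set (set 'M[F]_m) :=
  [set left_coset g H' | g in H].

Definition double_flag_variety (G K P Q : set 'M[F]_m) :
    set (set 'M[F]_m * set 'M[F]_m) :=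
  coset_space K Q `*` coset_space G P.

Definition diag_orbit K (x : set 'M[F]_m * set 'M[F]_m) :
    set (set 'M[F]_m * set 'M[F]_m) :=
  [set (left_coset k x.1, left_coset k x.2) | k in K].

Definition finitely_many_orbits K (X : set (set 'M[F]_m * set 'M[F]_m)) : Prop :=
  finite_set [set diag_orbit K x | x in X].

End Groups.

Arguments GL F m : clear implicits.

(* Main.v *)
Require Import Defs.
From HB Require Import structures.
From mathcomp Require Import all_boot all_order all_algebra.
From mathcomp Require Import boolp classical_sets cardinality reals.
From mathcomp Require Import complex.
From mathcomp Require Import ring.

Set Implicit Arguments.
Unset Strict Implicit.
Unset Printing Implicit Defensive.

Import GRing.Theory.
Local Open Scope classical_set_scope.
Local Open Scope ring_scope.

(** A point of the double flag variety is a pair of cosets (k Q, g P), that is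
the isotropic flag k L together with the flag g E, and the theorem says that
the symplectic group has finitely many orbits on the configurations of
subspaces so obtained. The proof puts every configuration into one of finitely
many normal forms. A normal form is a basis whose Gram matrix has entries 0,
1, -1 and in which every subspace of the configuration is spanned by signed
sums, i.e. combinations of basis vectors with coefficients 0, 1, -1
([adapted]). The Gram matrix and the set of signed sums lying in each subspace
range over finite sets, and they determine the configuration up to isometry
([adapted_transport]).

For an isotropic flag and one subspace U, complete the flag by the orthogonals
of its members and induct on the dimension by splitting off an orthogonal
summand compatible with everything ([adapted_self_dual_chain]). Take e in the
smallest nonzero member of the chain. If e lies in U, or in the orthogonal of
U, or outside the sum of the two, then e is part of a hyperbolic plane that
splits off. Otherwise e = a + b with a in U and b orthogonal to U; choosing a
as deep as possible in the chain produces a summand with basis a, b, c, d in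
which a and c lie in U and b and d are orthogonal to U.

For a Lagrangian L and a flag U1 <= U2, a Witt theorem relative to L
([witt_lagrangian]) extends to the whole space any isometry from U2 to another
such subspace that respects the intersections with the Lagrangians. What
remains to be classified is U2 with its possibly degenerate form, the isotropic
subspace which is the intersection of U2 and L, and the subspace U1
([adapted_isotropic]). Summands that meet the radical split off until the form is nondegenerate, and then the
first case applies to a one-step isotropic flag. *)

Lemma chain_min (T : eqType) (r : rel T) (p : pred T) (s : seq T) :
  transitive r -> reflexive r -> {in s &, forall x y, r x y || r y x} -> has p s ->
  exists x, [/\ x \in s, p x & {in s, forall y, p y -> r x y}].
Proof.
move=> rt rr; elim: s => //= y s IHs tot; case: (boolP (has p s)) => [ps _|nps].
  have [|x [xs px xmin]] := IHs _ ps.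
    by move=> u v us vs; apply: tot; rewrite inE ?us ?vs orbT.
  case: (boolP (p y && r y x)) => [/andP[py ryx]|nyx].
    exists y; split; rewrite ?mem_head // => z; rewrite inE => /predU1P[->//|zs pz].
    exact: rt ryx (xmin z zs pz).
  exists x; split; rewrite ?inE ?xs ?orbT // => z; rewrite inE.
  case/predU1P=> [-> py|]; last exact: xmin.
  move: nyx (tot x y); rewrite py /= => /negbTE ->.
  by rewrite orbF; apply; rewrite inE ?xs ?eqxx ?orbT.
rewrite orbF => py; exists y; split; rewrite ?mem_head // => z; rewrite inE.
by case/predU1P=> [->//|zs pz]; case/hasP: nps; exists z.
Qed.

(** * Signed sums *)

Section SignedSums.
Variables (F : fieldType) (V : vectType F).
Implicit Types (x y v : V) (s t : seq V) (U Y : {vspace V}).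

Fixpoint signed_sums s : seq V :=
  if s is v :: s' then
    let r := signed_sums s' in r ++ [seq v + x | x <- r] ++ [seq x - v | x <- r]
  else [:: 0].

Lemma size_signed_sums s : size (signed_sums s) = (3 ^ size s)%N.
Proof.
by elim: s => //= v s IHs; rewrite !size_cat !size_map IHs expnS !mulSn mul0n addn0.
Qed.

Lemma signed_sums_map (phi : {linear V -> V}) s :
  signed_sums (map phi s) = map phi (signed_sums s).
Proof.
elim: s => [|v s IHs] /=; first by rewrite linear0.
rewrite IHs !map_cat -!map_comp; congr (_ ++ (_ ++ _)); apply: eq_map => x /=.
  by rewrite linearD.
by rewrite linearB.
Qed.

Lemma signed_sums_cat s t x y :
  x \in signed_sums s -> y \in signed_sums t -> x + y \in signed_sums (s ++ t).
Proof.
move=> + yt; elim: s x => [|v s IHs] x /=.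
  by rewrite inE => /eqP ->; rewrite add0r.
rewrite !mem_cat => /or3P[/IHs->//|/mapP[z zs ->]|/mapP[z zs ->]].
  by rewrite -addrA map_f ?IHs ?orbT.
have h : (z + y) - v \in [seq x - v | x <- signed_sums (s ++ t)].
  by apply: (map_f (fun x => x - v)); apply: IHs.
by rewrite addrAC h !orbT.
Qed.

Lemma signed_sums0 s : 0 \in signed_sums s.
Proof. by elim: s => [|v s IHs] /=; rewrite ?inE // mem_cat IHs. Qed.

Lemma signed_sums_mem v s : v \in s -> v \in signed_sums s.
Proof.
elim: s => //= u s IHs; rewrite inE !mem_cat => /predU1P[<-|/IHs -> //].
by have := map_f (fun x => v + x) (signed_sums0 s); rewrite addr0 => ->; rewrite orbT.
Qed.

Lemma signed_sums_memN v s : v \in s -> - v \in signed_sums s.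
Proof.
elim: s => //= u s IHs; rewrite inE !mem_cat => /predU1P[<-|/IHs -> //].
by have := map_f (fun x => x - v) (signed_sums0 s); rewrite sub0r => ->; rewrite !orbT.
Qed.

(** The largest subspace of [U] that is spanned by signed sums of [s]; hence
[U <= hull s U] says that [U] itself is spanned by signed sums. *)
Definition hull s U : {vspace V} := <<[seq x <- signed_sums s | x \in U]>>.

Lemma signed_sums_span s x : x \in signed_sums s -> x \in <<s>>%VS.
Proof.
elim: s x => [|v s IHs] x /=; first by rewrite inE => /eqP ->; rewrite mem0v.
rewrite span_cons !mem_cat => /or3P[/IHs xs|/mapP[z /IHs zs ->]|/mapP[z /IHs zs ->]].
- by rewrite -[x]add0r memv_add ?mem0v.
- by rewrite memv_add ?memv_line.
- by rewrite addrC memv_add ?memvN ?memv_line.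
Qed.

Lemma hull_sub s U : (hull s U <= U)%VS.
Proof. by apply/span_subvP => x; rewrite mem_filter => /andP[]. Qed.

Lemma hull_span s U : (hull s U <= <<s>>)%VS.
Proof.
by apply/span_subvP => x; rewrite mem_filter => /andP[_]; apply: signed_sums_span.
Qed.

Lemma mem_hull s U x : x \in signed_sums s -> x \in U -> x \in hull s U.
Proof. by move=> xs xU; apply: memv_span; rewrite mem_filter xU. Qed.

Lemma hull_cat s t U Y : (hull s U + hull t (U :&: Y) <= hull (s ++ t) U)%VS.
Proof.
rewrite subv_add; apply/andP; split; apply/span_subvP => x; rewrite mem_filter.
  move=> /andP[xU xs]; apply: mem_hull xU.
  by rewrite -[x]addr0 signed_sums_cat ?signed_sums0.
rewrite memv_cap => /andP[/andP[xU _] xt]; apply: mem_hull xU.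
by rewrite -[x]add0r signed_sums_cat ?signed_sums0.
Qed.

(** The gluing step of the normal form: signed sums spanning one part of [U]
and signed sums spanning the rest give signed sums spanning [U]. *)
Lemma hull_split s t U Y :
  (U <= hull s U + Y)%VS -> (U :&: Y <= hull t (U :&: Y))%VS ->
  (U <= hull (s ++ t) U)%VS.
Proof.
move=> /subvP h1 h2; apply: (subv_trans _ (hull_cat s t U Y)).
apply/subvP => x xU; have /memv_addP[p ps [y yY xE]] := h1 x xU; rewrite xE.
apply: memv_add => //; apply: (subvP h2); rewrite memv_cap yY andbT.
have pU : p \in U by apply: subvP ps; apply: hull_sub.
by rewrite -[y](addKr p) -xE rpredD ?rpredN.
Qed.

(** [hull s U] depends on [U] only through this list of booleans, of length a
power of 3: it is the discrete invariant of [U] relative to [s]. *)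
Definition in_mask s U : bitseq := [seq x \in U | x <- signed_sums s].

Lemma hull_map (phi : 'End(V)) s U U' :
  in_mask s U = in_mask (map phi s) U' -> (phi @: hull s U)%VS = hull (map phi s) U'.
Proof.
rewrite /in_mask /hull limg_span => hm; congr span.
by rewrite [RHS]filter_mask -hm signed_sums_map -map_mask -filter_mask.
Qed.

End SignedSums.

(** * Orthogonality for a nondegenerate alternating form *)

Section Alternating.
Variables (F : fieldType) (V : vectType F) (w : {skew_symmetric V}).
Hypotheses (w_alt : forall x, w x x = 0) (w_nondeg : nondegenerate w).
Implicit Types (x y z a b c d e f g : V) (U X Y Z A M L : {vspace V}).
Implicit Types (s t : seq V) (Us FF : seq {vspace V}) (phi psi : 'End(V)).

Local Notation perp := (orthov w).

Lemma wC x y : w x y = - w y x.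
Proof. by rewrite hermC expr1 mulN1r. Qed.

Lemma wDl x y z : w (x + y) z = w x z + w y z. Proof. exact: linearDl. Qed.
Lemma wDr x y z : w x (y + z) = w x y + w x z. Proof. exact: linearDr. Qed.
Lemma wNl x z : w (- x) z = - w x z. Proof. exact: linearNl. Qed.
Lemma wNr x z : w x (- z) = - w x z. Proof. exact: linearNr. Qed.
Lemma wZl k x z : w (k *: x) z = k * w x z. Proof. exact: linearZl_LR. Qed.
Lemma wZr k x z : w x (k *: z) = k * w x z. Proof. exact: linearZr_LR. Qed.
Lemma w0l z : w 0 z = 0. Proof. exact: linear0l. Qed.
Lemma w0r z : w z 0 = 0. Proof. exact: linear0r. Qed.
Lemma w_sumr I (r : seq I) (E : I -> V) x :
  w x (\sum_(i <- r) E i) = \sum_(i <- r) w x (E i).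
Proof. exact: linear_sumr. Qed.
Lemma w_suml I (r : seq I) (E : I -> V) x :
  w (\sum_(i <- r) E i) x = \sum_(i <- r) w (E i) x.
Proof. exact: linear_sumlz. Qed.
Definition wE := (wDl, wDr, wNl, wNr, wZl, wZr, w0l, w0r, w_alt).

Lemma perpP U x : reflect {in U, forall y, w x y = 0} (x \in perp U).
Proof. exact: mem_orthovP. Qed.

Lemma perp_span s x : (x \in perp <<s>>) = all (fun y => w x y == 0) s.
Proof.
apply/perpP/allP => [h y ys|h y]; first by rewrite h // memv_span.
move=> /(coord_span (X := in_tuple s)) ->; rewrite w_sumr big1 // => i _.
by rewrite wZr (eqP (h _ (mem_nth _ _))) ?mulr0.
Qed.

Lemma perpS U Z : (U <= Z -> perp Z <= perp U)%VS.
Proof. by move=> /subvP h; apply/subvP => x /perpP hx; apply/perpP => y /h/hx. Qed.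

Lemma mem_perpD U Z x : (x \in perp (U + Z)) = (x \in perp U) && (x \in perp Z).
Proof.
apply/perpP/andP => [h|[/perpP hU /perpP hZ] y /memv_addP[u uU [z zZ ->]]].
  by split; apply/perpP => y yU; apply: h; move: y yU; apply/subvP;
     [exact: addvSl | exact: addvSr].
by rewrite wDr hU ?hZ ?addr0.
Qed.

(** By nondegeneracy the map from [V] to the coordinate space that sends [c] to
its products with a fixed basis is injective, hence onto. *)
Lemma riesz (l : {linear V -> F^o}) : exists c, forall x, w x c = l x.
Proof.
pose n := \dim {:V}; pose B : n.-tuple V := vbasis {:V}.
have Bb : basis_of {:V} B by exact: vbasisP.
pose T c : 'rV[F]_n := \row_i w B`_i c.
have linT : linear T.
  by move=> k x y; apply/rowP=> i; rewrite !mxE linearPr.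
pose TL : 'Hom(V, 'rV[F]_n) :=
  linfun (HB.pack T (GRing.isLinear.Build _ _ _ _ T linT) : {linear _ -> _}).
have TLE x : TL x = T x by rewrite lfunE.
have kT : lker TL == 0%VS.
  rewrite -subv0; apply/subvP => x; rewrite memv_ker TLE => /eqP Tx.
  rewrite -(eqP w_nondeg); apply/perpP => y _; rewrite wC.
  rewrite (coord_basis Bb (memvf y)) w_suml big1 ?oppr0 // => i _.
  by rewrite wZl; move/rowP/(_ i): Tx; rewrite !mxE => ->; rewrite mulr0.
have fT : limg TL = fullv.
  apply/eqP; rewrite eqEdim subvf /= limg_dim_eq ?(eqP kT) ?capv0 //.
  by rewrite dimvf dim_matrix mul1r leqnn.
have /memv_imgP[c _ hc] : (\row_i l B`_i : 'rV[F]_n) \in limg TL by rewrite fT memvf.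
exists c => x; rewrite (coord_basis Bb (memvf x)) w_suml linear_sum.
apply: eq_bigr => i _; rewrite wZl linearZ /=; congr (_ * _).
by move/rowP/(_ i): hc; rewrite TLE !mxE.
Qed.

(** A linear form that vanishes on [Z] and not at [a], represented by a vector. *)
Lemma sep Z a : a \notin Z -> exists2 c, c \in perp Z & w a c = 1.
Proof.
move=> aZ; pose p := (\1 - projv Z)%VF.
have pZ z : z \in Z -> p z = 0.
  by move=> zZ; rewrite add_lfunE opp_lfunE id_lfunE projv_id ?subrr.
have pa : p a != 0.
  apply: contra aZ; rewrite add_lfunE opp_lfunE id_lfunE subr_eq0 => /eqP ->.
  exact: memv_proj.
have [i ci] : exists i, coord (vbasis {:V}) i (p a) != 0.
  apply/existsP; apply: contraNT pa; rewrite negb_exists => /forallP h.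
  rewrite (coord_vbasis (memvf (p a))) big1 // => i _.
  by rewrite (eqP (negbNE (h i))) scale0r.
have [c hc'] := riesz (coord (vbasis {:V}) i \o p).
have hc x : w x c = coord (vbasis {:V}) i (p x) by exact: hc'.
exists ((w a c)^-1 *: c); last by rewrite wZr mulVf // (hc a).
apply/perpP => z zZ; have wz : w z c = 0 by rewrite hc pZ // linear0.
by rewrite wZl (wC c) wz oppr0 mulr0.
Qed.

Lemma perpK U : perp (perp U) = U.
Proof.
apply/vspaceP => x; apply/idP/idP => [/perpP h|xU]; last first.
  by apply/perpP => y /perpP h; rewrite wC h ?oppr0.
apply: contraT => /sep[c cU xc]; move: (h c cU); rewrite xc => /eqP.
by rewrite oner_eq0.
Qed.

Lemma sep_cap U Z a : a \notin (perp U + Z)%VS ->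
  exists c, [/\ c \in U, c \in perp Z & w a c = 1].
Proof.
by move=> /sep[c]; rewrite mem_perpD perpK => /andP[]; exists c.
Qed.

Lemma perp_cap U Z : perp (U :&: Z) = (perp U + perp Z)%VS.
Proof.
rewrite -[RHS]perpK; congr (perp _); apply/vspaceP => x.
by rewrite mem_perpD !perpK memv_cap.
Qed.

(** [perp U] is the kernel of the map that takes the products with a basis of
[U]; that map is onto because every linear form is represented by a vector. *)
Lemma dim_perp U : (\dim U + \dim (perp U) = \dim {:V})%N.
Proof.
pose B : (\dim U).-tuple V := vbasis U.
pose T c : 'rV[F]_(\dim U) := \row_i w c B`_i.
have linT : linear T.
  by move=> k x y; apply/rowP=> i; rewrite !mxE wDl wZl.
pose TL : 'Hom(V, 'rV[F]_(\dim U)) :=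
  linfun (HB.pack T (GRing.isLinear.Build _ _ _ _ T linT) : {linear _ -> _}).
have TLE x : TL x = T x by rewrite lfunE.
have kT : lker TL = perp U.
  apply/vspaceP => x; rewrite memv_ker TLE.
  have -> : (x \in perp U) = (x \in perp <<B>>) by rewrite (span_basis (vbasisP U)).
  rewrite perp_span.
  apply/eqP/allP => [/rowP Tx y /(nthP 0)[k]|h].
    by rewrite size_tuple => ltiU <-; move: (Tx (Ordinal ltiU)); rewrite !mxE => /eqP.
  by apply/rowP => i; rewrite !mxE; apply/eqP/h/mem_nth; rewrite size_tuple.
have fT : limg TL = fullv.
  apply/eqP; rewrite eqEsubv subvf /=; apply/subvP => v _.
  have [f hf] := linear_of_free B
    (mkseq (fun i => if insub i is Some j then v 0 j : F^o else 0) (\dim U)).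
  have {}hf := hf (basis_free (vbasisP U)).
  rewrite size_mkseq size_tuple in hf; have {}hf := hf erefl.
  have [c hc] := riesz f; apply/memv_imgP; exists (- c); rewrite ?memvf // TLE.
  apply/rowP => i; rewrite mxE wNl wC opprK hc.
  have := congr1 (fun q : seq F^o => nth 0 q i) hf.
  by rewrite (nth_map 0) ?size_tuple // nth_mkseq // valK.
by have := limg_ker_dim TL fullv; rewrite capfv fT kT addnC dimvf dim_matrix mul1r.
Qed.

(** * Adapted bases *)

Definition small_gram s := {in s &, forall x y, w x y \in [:: 0; 1; -1]}.

(** The normal form: relative to [s], both the form on [Y] and the members of
[Us] are described by discrete data. *)
Definition adapted Y s Us :=
  [/\ basis_of Y s, small_gram s & {in Us, forall U, U <= hull s U}%VS].

(** Adapted bases are glued along an orthogonal decomposition of [Y] into the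
span of [s] and [Y'] with which every member of [Us] is compatible: each is the
sum of the signed sums of [s] that it contains and of its trace on [Y']. *)
Lemma adapted_cat Y Y' s s' Us :
  (\dim Y' + size s <= \dim Y)%N -> small_gram s -> (Y' <= perp <<s>>)%VS ->
  (Y' <= Y)%VS ->
  {in Y :: Us, forall U, U <= hull s U + Y'}%VS ->
  adapted Y' s' [seq (U :&: Y')%VS | U <- Us] -> adapted Y (s ++ s') Us.
Proof.
move=> dimY gs os Y'Y splitU [bs' gs' hs']; split.
- rewrite basisEdim size_cat span_cat addnC.
  rewrite -(size_basis (X := in_tuple s') bs') dimY andbT.
  apply/(subv_trans (splitU Y (mem_head _ _)))/addvS; first exact: hull_span.
  by rewrite (span_basis bs').
- have ortho x y : x \in s -> y \in s' -> w x y = 0.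
    move=> xs ys; rewrite wC; move/subvP: os => /(_ y (basis_mem bs' ys)) /perpP.
    by move=> -> //; rewrite ?oppr0 // memv_span.
  move=> x y; rewrite !mem_cat => /orP[] xs /orP[] ys.
  + exact: gs.
  + by rewrite ortho // mem_head.
  + by rewrite wC (ortho y x) // oppr0 mem_head.
  + exact: gs'.
- move=> U UUs; apply: (hull_split (Y := Y')).
    by apply: splitU; rewrite inE UUs orbT.
  by apply: hs'; apply: map_f.
Qed.

Definition isometric_on U phi := {in U &, forall x y, w (phi x) (phi y) = w x y}.

(** Equal discrete data give an isometry, namely the linear map that sends one
basis to the other: it matches the signed sums of the two bases one by one. *)
Lemma transport Y Y' s s' : basis_of Y s -> basis_of Y' s' -> size s = size s' ->
  (forall i j, (i < size s)%N -> (j < size s)%N -> w s`_i s`_j = w s'`_i s'`_j) ->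
  exists phi : 'End(V),
  [/\ isometric_on Y phi, (phi @: Y)%VS = Y' &
   forall U U', (U <= hull s U)%VS -> (U' <= hull s' U')%VS ->
     in_mask s U = in_mask s' U' -> (phi @: U)%VS = U'].
Proof.
move=> bs bs' ss gs; have [f hf] := linear_of_free s s'.
have {}hf := hf (basis_free bs) (esym ss).
pose phi : 'End(V) := linfun f; have phiE : map phi s = s'.
  by rewrite -hf; apply: eq_map => x; rewrite lfunE.
exists phi; split.
- have phii i : (i < size s)%N -> phi s`_i = s'`_i.
    by move=> lti; rewrite -phiE (nth_map 0).
  have phiS (c : 'I_(size s) -> F) :
      phi (\sum_i c i *: s`_i) = \sum_i c i *: s'`_i.
    by rewrite linear_sum; apply: eq_bigr => i _; rewrite linearZ /= phii.
  move=> x y xY yY; rewrite (coord_basis (X := in_tuple s) bs xY).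
  rewrite (coord_basis (X := in_tuple s) bs yY) !phiS !w_suml.
  apply: eq_bigr => i _; rewrite !w_sumr; apply: eq_bigr => j _.
  by rewrite !wZl !wZr gs.
- by rewrite -(span_basis bs) limg_span phiE (span_basis bs').
- move=> U U' hU hU' hm.
  have -> : U = hull s U by apply/eqP; rewrite eqEsubv hU hull_sub.
  have -> : U' = hull s' U' by apply/eqP; rewrite eqEsubv hU' hull_sub.
  by rewrite -phiE; apply: hull_map; rewrite phiE.
Qed.

(** Iterated along a list of vectors, this bounds from above the dimension of the
orthogonal complement of a summand that is split off. *)
Lemma dim_cut Y v g s : v \in Y -> v \in perp <<s>> -> w v g != 0 ->
  (\dim (Y :&: perp <<g :: s>>) < \dim (Y :&: perp <<s>>))%N.
Proof.
move=> vY vs vg; have sub : (Y :&: perp <<g :: s>> <= Y :&: perp <<s>>)%VS.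
  by apply/capvS/perpS; rewrite ?subvv // span_cons addvSr.
rewrite ltn_neqAle dimvS // andbT (dimv_leqif_eq sub).
apply: contra vg => /eqP eqY.
have : v \in (Y :&: perp <<g :: s>>)%VS by rewrite eqY memv_cap vY.
by rewrite memv_cap perp_span /= => /and3P[].
Qed.

Lemma hull_scale s U k v : v \in signed_sums s -> k = 0 \/ v \in U ->
  k *: v \in hull s U.
Proof. by move=> vs [->|vU]; rewrite ?scale0r ?mem0v // memvZ // mem_hull. Qed.

(** Compatibility of [U] with a splitting is checked on an explicit projection
[p] onto the summand spanned by [s]. *)
Lemma split_by s U Y' (p : V -> V) :
  {in U, forall x, p x \in hull s U /\ x - p x \in Y'} -> (U <= hull s U + Y')%VS.
Proof.
move=> h; apply/subvP => x /h[h1 h2]; rewrite -[x](subrK (p x)) addrC.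
exact: memv_add.
Qed.

(** * An isotropic flag and one subspace *)

(** The form on [Y] will be nondegenerate, so the last condition makes [FF]
stable under the duality of the subspaces of [Y]. *)
Definition self_dual_chain Y FF :=
  [/\ Y \in FF, {in FF, forall A, A <= Y}%VS,
      {in FF &, forall A B, (A <= B)%VS || (B <= A)%VS} &
      {in FF, forall A, (Y :&: perp A)%VS \in FF}].

(** The orthogonal of a member [A] inside [Y'] is the trace on [Y'] of the
orthogonal of [A] inside [Y], because [A] is compatible with the splitting. *)
Lemma self_dual_cut Y FF s (Y' := (Y :&: perp <<s>>)%VS) :
  self_dual_chain Y FF -> {in FF, forall A, A <= hull s A + Y'}%VS ->
  self_dual_chain Y' [seq (A :&: Y')%VS | A <- FF].
Proof.
move=> [YF FY tot FP] split; split.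
- by apply/mapP; exists Y => //; rewrite capvA capvv.
- by move=> _ /mapP[A AF ->]; apply: capvSr.
- move=> _ _ /mapP[A AF ->] /mapP[B BF ->].
  by case/orP: (tot A B AF BF) => h; rewrite (capvS h (subvv _)) ?orbT.
move=> _ /mapP[A AF ->]; apply/mapP; exists (Y :&: perp A)%VS; first exact: FP.
apply/vspaceP => x; rewrite !memv_cap; case: (x \in Y) => //=.
case: (boolP (x \in perp <<s>>)) => xs; rewrite ?andbF //= !andbT.
apply/idP/idP; last by apply/subvP/perpS/capvSl.
move=> /perpP h; apply/perpP => y yA.
have /memv_addP[p ps [q qY yE]] := subvP (split A AF) y yA.
rewrite yE wDr (h q) ?addr0.
  by move/perpP: xs; apply; apply: subvP ps; exact: hull_span.
rewrite memv_cap qY andbT -[q](addKr p) -yE rpredD ?rpredN //.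
exact: (subvP (hull_sub s A)).
Qed.

Lemma nondeg_cut Y s (Y' := (Y :&: perp <<s>>)%VS) :
  (Y :&: perp Y = 0)%VS -> (Y <= hull s Y + Y')%VS -> (Y' :&: perp Y' = 0)%VS.
Proof.
move=> Y0 split; apply/eqP; rewrite -subv0 -Y0; apply/subvP => x.
rewrite !memv_cap => /andP[/andP[-> /perpP xs] /perpP xY']; apply/perpP => y yY.
have /memv_addP[p ps [q qY ->]] := subvP split y yY.
rewrite wDr (xY' q) // xs ?addr0 //.
by apply: subvP ps; exact: hull_span.
Qed.

Lemma notin_perp_add Y Z e : (Y :&: perp Y = 0)%VS -> (Z <= Y)%VS -> e \in Y ->
  e \notin Z -> e \notin (perp Y + Z)%VS.
Proof.
move=> Y0 /subvP ZY eY; apply: contra => /memv_addP[y yY [z zZ eE]].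
have : y \in (Y :&: perp Y)%VS.
  by rewrite memv_cap yY andbT -[y](addrK z) -eE rpredB // ZY.
by rewrite Y0 memv0 eE => /eqP ->; rewrite add0r.
Qed.

(** Biduality inside a nondegenerate [Y]. *)
Lemma mem_perpK_in Y A x : (Y :&: perp Y = 0)%VS -> (A <= Y)%VS -> x \in Y ->
  x \in perp (Y :&: perp A)%VS -> x \in A.
Proof.
move=> Y0 AY xY /perpP h; apply: contraT => xA.
have [c [cY cA xc]] := sep_cap (notin_perp_add Y0 AY xY xA).
by move: (h c); rewrite memv_cap cY cA xc => /(_ isT) /eqP; rewrite oner_eq0.
Qed.

(** The plane spanned by a hyperbolic pair is compatible with [U] as soon as
every coefficient that occurs in the projection of a vector of [U] either
vanishes or multiplies a vector of [U]. *)
Lemma split_pair Y U e f (Y' := (Y :&: perp <<[:: e; f]>>)%VS) :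
  w e f = 1 -> (U <= Y)%VS -> e \in Y -> f \in Y ->
  (e \in U \/ {in U, forall x, w x f = 0}) ->
  (f \in U \/ {in U, forall x, w x e = 0}) ->
  (U <= hull [:: e; f] U + Y')%VS.
Proof.
move=> ef /subvP UY eY fY he hf.
apply: (@split_by _ _ _ (fun x => w x f *: e - w x e *: f)) => x xU; split.
  have m v : v \in [:: e; f] -> v \in signed_sums [:: e; f] by exact: signed_sums_mem.
  rewrite rpredB //; apply: hull_scale; rewrite ?m ?inE ?eqxx ?orbT //.
    by case: he => [->|->//]; [right|left].
  by case: hf => [->|->//]; [right|left].
rewrite memv_cap; apply/andP; split; first by rewrite !memvB ?memvZ ?(UY x xU).
rewrite perp_span /= !wE.
rewrite [w f e]wC ef; apply/and3P; split=> //; apply/eqP; ring.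
Qed.

Lemma small_gram_pair e f : w e f = 1 -> small_gram [:: e; f].
Proof.
move=> ef; have fe : w f e = -1 by rewrite wC ef.
by move=> x y; rewrite !inE => /orP[]/eqP-> /orP[]/eqP->;
   rewrite ?w_alt ?ef ?fe eqxx ?orbT.
Qed.

Definition spherical_data Y FF U :=
  [/\ (Y :&: perp Y = 0)%VS, self_dual_chain Y FF & (U <= Y)%VS].

(** One step of the induction on the dimension: split off the span of [s] and
apply the induction hypothesis to its orthogonal complement in [Y]. *)
Lemma adapted_step Y FF U s :
  spherical_data Y FF U -> (\dim (Y :&: perp <<s>>) + size s <= \dim Y)%N ->
  (0 < size s)%N -> small_gram s ->
  (U <= hull s U + (Y :&: perp <<s>>))%VS ->
  {in FF, forall A, A <= hull s A + (Y :&: perp <<s>>)}%VS ->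
  (forall Y' FF' U', (\dim Y' < \dim Y)%N -> spherical_data Y' FF' U' ->
     exists s', adapted Y' s' (U' :: FF')) ->
  exists s', adapted Y s' (U :: FF).
Proof.
move=> [Y0 ch UY] dimY s0 gs sU sF IH.
set Y' := (Y :&: perp <<s>>)%VS in dimY sU sF *.
have YF : Y \in FF by case: ch.
have [||s' ads'] := IH Y' [seq (A :&: Y')%VS | A <- FF] (U :&: Y')%VS.
- by apply: leq_trans dimY; rewrite -addn1 leq_add2l.
- by split; [exact: nondeg_cut (sF _ YF) | exact: self_dual_cut | exact: capvSr].
exists (s ++ s'); apply: (@adapted_cat _ Y' _ _ (U :: FF)) => //.
- exact: capvSr.
- exact: capvSl.
move=> A; rewrite !inE => /or3P[/eqP->|/eqP->//|]; [exact: sF|exact: sF].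
Qed.

(** Let [e] lie in every nonzero member of the chain. If the orthogonal of [A] in
[Y] is nonzero then it contains [e], so [A] is orthogonal to [e]. *)
Lemma chain_flag Y FF e A : (Y :&: perp Y = 0)%VS -> self_dual_chain Y FF ->
  {in FF, forall B, B != 0%VS -> e \in B} -> A \in FF ->
  [\/ A = 0%VS, A = Y | e \in A /\ {in A, forall x, w x e = 0}].
Proof.
move=> Y0 [YF FY tot FP] he AF.
have [->|An0] := eqVneq A 0%VS; first by constructor 1.
have [pA0|pAn0] := eqVneq (Y :&: perp A)%VS 0%VS.
  constructor 2; apply/eqP; rewrite eqEsubv FY //=; apply/subvP => x xY.
  by apply: (mem_perpK_in Y0 (FY A AF)); rewrite // pA0 orthov0 memvf.
constructor 3; split; first exact: he.
have := he _ (FP A AF) pAn0; rewrite memv_cap => /andP[_ /perpP h] x xA.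
by rewrite wC h ?oppr0.
Qed.

Lemma split_off_pair Y FF U e f :
  spherical_data Y FF U -> {in FF, forall B, B != 0%VS -> e \in B} ->
  w e f = 1 -> f \in Y ->
  (e \in U \/ {in U, forall x, w x f = 0}) ->
  (f \in U \/ {in U, forall x, w x e = 0}) ->
  (forall Y' FF' U', (\dim Y' < \dim Y)%N -> spherical_data Y' FF' U' ->
     exists s', adapted Y' s' (U' :: FF')) ->
  exists s', adapted Y s' (U :: FF).
Proof.
move=> data he ef fY h1 h2; have [Y0 ch UY] := data; have [YF FY tot FP] := ch.
have eY : e \in Y.
  apply: he => //; apply/eqP => Y00; move: fY ef; rewrite Y00 memv0 => /eqP ->.
  by rewrite w0r => /esym/eqP; rewrite oner_eq0.
apply: (@adapted_step _ _ _ [:: e; f]) => //.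
- apply: (@leq_trans (\dim (Y :&: perp <<[:: f]>>)).+1); last first.
    rewrite -[X in (_ < \dim X)%N]capvf -(orthov0 w) -span_nil.
    apply: (@dim_cut _ e) => //; first by rewrite perp_span.
    by rewrite ef oner_neq0.
  rewrite /= addn2 !ltnS; apply: (@dim_cut _ f) => //.
    by rewrite perp_span /= w_alt eqxx.
  by rewrite wC ef oppr_eq0 oner_neq0.
- exact: small_gram_pair.
- exact: split_pair.
move=> A AF; apply: split_pair => //; first exact: FY.
- case: (chain_flag Y0 ch he AF) => [->|->|[eA _]]; [right|left|left] => //.
  by move=> x; rewrite memv0 => /eqP ->; rewrite w0l.
case: (chain_flag Y0 ch he AF) => [->|->|[eA hA]]; [right|left|right] => //.
by move=> x; rewrite memv0 => /eqP ->; rewrite w0l.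
Qed.

(** The four vectors form two orthogonal hyperbolic pairs: [a], [c] in [U] and
[b], [d] in the orthogonal of [U]. A member [A] of the chain need not contain
any of them: it may meet their span in [e = a + b], or in [e] and [c - d]. If
[a] is not in [A], then [A <= M] is orthogonal to [c - d], so the projections of
[A] involve [a] and [b] only through [e]; and the dual statement, for the
orthogonal of [A], controls [c] and [d]. *)
Lemma split_off_quad Y FF U e a b c d M :
  spherical_data Y FF U -> {in FF, forall B, B != 0%VS -> e \in B} ->
  e = a + b -> e \in M -> a \in U -> b \in (Y :&: perp U)%VS ->
  c \in U -> d \in (Y :&: perp U)%VS -> c - d \in perp M -> w a c = 1 ->
  {in FF, forall A, a \in A \/ (A <= M)%VS} ->
  (forall Y' FF' U', (\dim Y' < \dim Y)%N -> spherical_data Y' FF' U' ->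
     exists s', adapted Y' s' (U' :: FF')) ->
  exists s', adapted Y s' (U :: FF).
Proof.
move=> data he eE eM aU + cU + cdM ac aM IH; rewrite !memv_cap.
move=> /andP[bY /perpP bU] /andP[dY /perpP dU].
have [Y0 ch UY] := data; have [YF FY tot FP] := ch.
have aY := subvP UY a aU; have cY := subvP UY c cU.
have ba : w b a = 0 by exact: bU.
have bc : w b c = 0 by exact: bU.
have da : w d a = 0 by exact: dU.
have dc : w d c = 0 by exact: dU.
have ab : w a b = 0 by rewrite wC ba oppr0.
have cb : w c b = 0 by rewrite wC bc oppr0.
have ad : w a d = 0 by rewrite wC da oppr0.
have cd : w c d = 0 by rewrite wC dc oppr0.
have ca : w c a = -1 by rewrite wC ac.
have db : w d b = -1.
  have := perpP _ _ cdM e eM; rewrite eE !wE ca cb da => /eqP.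
  by rewrite oppr0 addr0 add0r addr_eq0 opprK => /eqP <-.
have bd : w b d = 1 by rewrite wC db opprK.
pose s := [:: a; b; c; d].
have ms v : v \in s -> v \in signed_sums s by exact: signed_sums_mem.
have es : a + b \in signed_sums s.
  by apply: (@signed_sums_cat _ _ [:: a] [:: b; c; d]); apply/signed_sums_mem/mem_head.
have cds : c - d \in signed_sums s.
  apply: (@signed_sums_cat _ _ [:: a; b; c] [:: d]).
    by apply: signed_sums_mem; rewrite !inE eqxx !orbT.
  exact/signed_sums_memN/mem_head.
(* the orthogonal projection onto the span of s *)
pose p x := w x c *: a + w x d *: b - w x a *: c - w x b *: d.
have pY' x : x \in Y -> x - p x \in (Y :&: perp <<s>>)%VS.
  move=> xY; rewrite memv_cap; apply/andP; split; first by rewrite !(memvB, memvD, memvZ).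
  rewrite perp_span /= !wE ?ab ?ac ?ad ?ba ?bc ?bd ?ca ?cb ?cd ?da ?db ?dc.
  by apply/and5P; split=> //; apply/eqP; ring.
apply: (@adapted_step _ _ _ s) => //.
- have -> : (\dim Y = \dim (Y :&: perp <<[::]>>))%N by rewrite span_nil orthov0 capvf.
  have h1 := @dim_cut Y b d [::] bY; have h2 := @dim_cut Y a c [:: d] aY.
  have h3 := @dim_cut Y d b [:: c; d] dY; have h4 := @dim_cut Y c a [:: b; c; d] cY.
  move: h1 h2 h3 h4; rewrite !perp_span /= bd ac db ca ad dc cb cd !w_alt !eqxx.
  rewrite oppr_eq0 oner_neq0 => /(_ isT isT) h1 /(_ isT isT) h2.
  move=> /(_ isT isT) h3 /(_ isT isT) h4; rewrite addn4.
  apply: leq_trans h1; rewrite ltnS; apply: leq_trans h2; rewrite ltnS.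
  by apply: leq_trans h3; rewrite ltnS.
- move=> x y; rewrite !inE => /or4P[]/eqP-> /or4P[]/eqP->;
  by rewrite ?w_alt ?ab ?ac ?ad ?ba ?bc ?bd ?ca ?cb ?cd ?da ?db ?dc eqxx ?orbT.
- apply: (@split_by _ _ _ p) => x xU; split; last exact/pY'/(subvP UY).
  have -> : p x = w x c *: a - w x a *: c.
    by rewrite /p [w x d]wC [w x b]wC (dU x) // (bU x) // oppr0 !scale0r addr0 subr0.
  by rewrite memvB // hull_scale ?ms ?inE ?eqxx ?orbT //; right.
move=> A AF; apply: (@split_by _ _ _ p) => x xA; split; last exact/pY'/(subvP (FY _ AF)).
have [A0|AY|[eA hA]] := chain_flag Y0 ch he AF.
- move: xA; rewrite A0 memv0 => /eqP ->.
  by rewrite /p !w0l !scale0r !addr0 !subr0 mem0v.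
- by rewrite /p AY !(memvB, memvD) // hull_scale ?ms ?inE ?eqxx ?orbT //; right.
have xb : w x b = - w x a.
  by apply/eqP; rewrite -addr_eq0 -wDr addrC -eE hA.
(* the hypothesis on the chain is used here for the orthogonal of A in Y *)
have h : w x a = 0 \/ c - d \in A.
  have [aB|BM] := aM _ (FP A AF).
    left; move: aB; rewrite memv_cap => /andP[_ /perpP aA].
    by rewrite wC aA ?oppr0.
  right; apply: (mem_perpK_in Y0 (FY A AF)); first by rewrite memvB.
  exact: subvP (perpS BM) _ cdM.
have [aA|AM] := aM A AF.
  have bA : b \in A by rewrite -[b](addKr a) -eE memvD // memvN.
  have -> : p x = w x c *: a + w x d *: b - w x a *: (c - d).
    by rewrite /p xb scaleNr opprK scalerBr opprB addrAC addrA.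
  apply: memvB; last exact: hull_scale.
  by apply: memvD; apply: hull_scale; rewrite ?ms ?inE ?eqxx ?orbT //; right.
have xcd : w x c = w x d.
  apply/eqP; rewrite -subr_eq0 -wNr -wDr wC.
  by rewrite (perpP _ _ cdM) ?oppr0 // (subvP AM).
have -> : p x = w x c *: (a + b) - w x a *: (c - d).
  by rewrite /p xb xcd scaleNr opprK scalerBr scalerDr opprB addrAC addrA.
by apply: memvB; apply: hull_scale => //; rewrite -eE; right.
Qed.

(** The case distinction is on the position of [e], a vector of the smallest
nonzero member of the chain, relative to [U] and [perp U]. In the last case the
decomposition [e = a + b] is chosen with [a] in the smallest possible member
[A1] of the chain; [M0] is the largest member in which there is no such [a]. *)
Theorem adapted_self_dual_chain Y FF U :
  spherical_data Y FF U -> exists s, adapted Y s (U :: FF).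
Proof.
have [n] := ubnP (\dim Y); elim: n Y FF U => // n IHn Y FF U ltYn data.
have IH Y' FF' U' : (\dim Y' < \dim Y)%N -> spherical_data Y' FF' U' ->
    exists s', adapted Y' s' (U' :: FF').
  by move=> lt; apply: IHn; apply: leq_trans lt ltYn.
have [Y0 ch UY] := data; have [YF FY tot FP] := ch.
have [Yz|Yn0] := eqVneq Y 0%VS.
  exists [::]; split; first by rewrite Yz nil_basis.
    by [].
  move=> A; rewrite inE => /predU1P[->|/FY].
    by rewrite (subv_trans UY) // Yz sub0v.
  by move=> AY; rewrite (subv_trans AY) // Yz sub0v.
have sub_tr : transitive (fun A B : {vspace V} => (A <= B)%VS).
  by move=> A B C; apply: subv_trans.
have [A0 [A0F A0n0 A0min]] := @chain_min _ (fun A B => A <= B)%VS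
  (fun A => A != 0%VS) FF sub_tr (@subvv _ _) tot
  (introT hasP (ex_intro2 _ _ Y YF Yn0)).
pose e := vpick A0; have eA0 : e \in A0 by exact: memv_pick.
have en0 : e != 0 by rewrite vpick0.
have he : {in FF, forall B, B != 0%VS -> e \in B}.
  by move=> B BF Bn0; apply: subvP (A0min B BF Bn0) e eA0.
have eY : e \in Y by exact: he.
have e0 : e \notin 0%VS by rewrite memv0.
have symm x y : w x y = 0 -> w y x = 0 by move=> h; rewrite wC h oppr0.
(* the partner f is taken as far inside U and perp U as e allows *)
have [eU|eU] := boolP (e \in U); have [ep|ep] := boolP (e \in perp U).
- have [f [fY _ ef]] := sep_cap (notin_perp_add Y0 (sub0v _) eY e0).
  apply: (split_off_pair data he ef fY) => //; [by left|right=> x xU].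
  exact/symm/(perpP _ _ ep).
- have [f [fU _ ef]] : exists c, [/\ c \in U, c \in perp 0%VS & w e c = 1].
    by apply: sep_cap; rewrite addv0.
  by apply: (split_off_pair data he ef (subvP UY f fU)) => //; left.
- have [f [fY fU ef]] := sep_cap (notin_perp_add Y0 UY eY eU).
  by apply: (split_off_pair data he ef fY) => //; right=> x xU; apply/symm;
    [apply: (perpP _ _ fU)|apply: (perpP _ _ ep)].
have [eUp|eUp] := boolP (e \in (U + perp U)%VS); last first.
  have [f + ef] := sep eUp; rewrite mem_perpD perpK => /andP[fU' fU].
  apply: (split_off_pair data he ef (subvP UY f fU)) => //; [right=> x xU|by left].
  exact/symm/(perpP _ _ fU').
pose p A := e \in (U :&: A + Y :&: perp U)%VS.
have pY : p Y.
  have /memv_addP[a aU [b bU eE]] := eUp; have aY := subvP UY a aU.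
  rewrite /p {1}eE memv_add // !memv_cap ?aU ?bU // andbT.
  by rewrite -[b](addKr a) -eE memvD // memvN.
have [A1 [A1F pA1 A1min]] := @chain_min _ (fun A B => A <= B)%VS p FF sub_tr
  (@subvv _ _) tot (introT hasP (ex_intro2 _ _ Y YF pY)).
have np0 : ~~ p 0%VS by rewrite /p capv0 add0v memv_cap eY.
have zF : 0%VS \in FF by rewrite -Y0 FP.
have [||||M0 [M0F npM0 M0max]] := @chain_min _ (fun A B => B <= A)%VS (predC p) FF.
- by move=> A B C h1 h2; apply: subv_trans h2 h1.
- exact: subvv.
- by move=> A B AF BF; rewrite orbC tot.
- by apply/hasP; exists 0%VS.
(* adding e only matters when M0 = 0, since otherwise e is in M0 *)
pose M := (M0 + <[e]>)%VS.
have MY : (M <= Y)%VS by rewrite subv_add FY //= -memvE.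
have /memv_addP[a + [b bYU eE]] := pA1; rewrite memv_cap => /andP[aU aA1].
have aY := subvP UY a aU.
have [c [cU cUM ac]] : exists c, [/\ c \in U, c \in perp (U :&: M)%VS & w a c = 1].
  apply: sep_cap; apply/negP => /memv_addP[w0 w0U [u uUM aE]].
  move: uUM; rewrite memv_cap => /andP[uU uM].
  have [Mz|Mn0] := eqVneq M0 0%VS.
    move: uM; rewrite /M Mz add0v => /vlineP[k uE].
    have [k0|kn0] := eqVneq k 0.
      case/negP: ep; rewrite eE aE uE k0 scale0r addr0 memvD //.
      by move: bYU; rewrite memv_cap => /andP[].
    case/negP: eU; rewrite -[e](scalerK kn0) -uE; exact: memvZ.
  have eM0 := he _ M0F Mn0.
  case/negP: npM0; rewrite /p eE aE [w0 + u]addrC -addrA memv_add //.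
    rewrite memv_cap uU; move: uM; rewrite /M.
    by have /addv_idPl -> : (<[e]> <= M0)%VS by rewrite -memvE.
  rewrite memvD // memv_cap w0U andbT -[w0](addrK u) -aE memvB //.
  exact: subvP UY u uU.
(* c is orthogonal to the intersection of U and M, so c = d0 + m with d0
   orthogonal to U and m to M; d is the component of d0 in Y *)
have := cUM; rewrite perp_cap => /memv_addP[d0 d0U [m mM cE]].
have : d0 \in (Y + perp Y)%VS.
  by rewrite addvC -{2}[Y]perpK -perp_cap Y0 orthov0 memvf.
move=> /memv_addP[d dY [d' d'Y d0E]].
have dE : d = d0 - d' by rewrite d0E addrK.
apply: (@split_off_quad _ _ _ e a b c d M data he eE) => //.
- by apply: (subvP (addvSr _ _)); exact: memv_line.
- by rewrite memv_cap dY dE memvB // (subvP (perpS UY)).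
- have -> : c - d = m + d' by rewrite cE dE opprB addrC addrA subrK addrC.
  by rewrite memvD // (subvP (perpS MY)).
move=> A AF; have [pA|npA] := boolP (p A).
  by left; apply: subvP (A1min A AF pA) _ aA1.
by right; apply: subv_trans (M0max A AF npA) (addvSl _ _).
Qed.

(** * An isotropic and an arbitrary subspace for a degenerate form *)

Lemma adapted_sub Y s Us Us' : {subset Us' <= Us} -> adapted Y s Us -> adapted Y s Us'.
Proof. by move=> sub [bs gs hs]; split=> // U /sub /hs. Qed.

Definition isotropic_data Y A U := [/\ (A <= Y)%VS, (A <= perp A)%VS & (U <= Y)%VS].

Lemma adapted_step_isotropic Y Y' A U s :
  isotropic_data Y A U -> (\dim Y' + size s <= \dim Y)%N ->
  (0 < size s)%N -> small_gram s -> (Y' <= perp <<s>>)%VS -> (Y' <= Y)%VS ->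
  {in [:: Y; A; U], forall X, X <= hull s X + Y'}%VS ->
  (forall Y' A' U', (\dim Y' < \dim Y)%N -> isotropic_data Y' A' U' ->
     exists s', adapted Y' s' [:: A'; U']) ->
  exists s', adapted Y s' [:: A; U].
Proof.
move=> [AY AA UY] dimY s0 gs os Y'Y split IH.
have [||s' ads'] := IH Y' (A :&: Y')%VS (U :&: Y')%VS.
- by apply: leq_trans dimY; rewrite -addn1 leq_add2l.
- split; try exact: capvSr.
  by rewrite (subv_trans (capvSl _ _)) // (subv_trans AA) // perpS ?capvSl.
by exists (s ++ s'); apply: (@adapted_cat _ Y').
Qed.

(** A vector [r] of the radical is orthogonal to all of [Y], so splitting it off
only requires a hyperplane [Y :&: perp <[g]>] that avoids [r] and contains
those of [A] and [U] that do not contain [r]. *)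
Lemma split_off_radical Y A U r g :
  isotropic_data Y A U -> r \in (Y :&: perp Y)%VS -> w r g = 1 ->
  r \in A \/ g \in perp A -> r \in U \/ g \in perp U ->
  (forall Y' A' U', (\dim Y' < \dim Y)%N -> isotropic_data Y' A' U' ->
     exists s', adapted Y' s' [:: A'; U']) ->
  exists s', adapted Y s' [:: A; U].
Proof.
move=> data + rg hA hU; rewrite memv_cap => /andP[rY /perpP rp].
have [AY AA UY] := data.
have split X : (X <= Y)%VS -> r \in X \/ g \in perp X ->
    (X <= hull [:: r] X + (Y :&: perp <<[:: g]>>))%VS.
  move=> XY rX; apply: (@split_by _ _ _ (fun x => w x g *: r)) => x xX; split.
    apply: hull_scale; first exact/signed_sums_mem/mem_head.
    by case: rX => [|/perpP gX]; [right|left; rewrite wC gX ?oppr0].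
  rewrite memv_cap; apply/andP; split; first by rewrite memvB ?memvZ // (subvP XY).
  by rewrite perp_span /= !wE rg mulr1 subrr eqxx.
apply: (@adapted_step_isotropic _ (Y :&: perp <<[:: g]>>)%VS _ _ [:: r]) => //.
- have := @dim_cut Y r g [::] rY; rewrite perp_span /= rg oner_neq0 addn1.
  by rewrite span_nil orthov0 capvf => ->.
- by move=> x y; rewrite !inE => /eqP -> /eqP ->; rewrite w_alt eqxx.
- apply/subvP => x; rewrite memv_cap !perp_span /= => /andP[xY _].
  by rewrite wC rp ?oppr0 ?eqxx.
- exact: capvSl.
move=> X; rewrite !inE => /or3P[]/eqP->; apply: split => //; by left.
Qed.

(** When a radical vector [r = a + u] lies in neither [A] nor [U], a hyperbolic
pair [a], [c] has to be split off together with [r]. The complement is cut out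
by [a], [c] and [g], where [g] represents the linear form that vanishes on [A],
equals [- w _ c] on [U], and hence takes the value 1 at [r]. *)
Lemma split_off_triple Y A U r a u c g :
  isotropic_data Y A U -> r = a + u -> r \in (Y :&: perp Y)%VS -> a \in A -> u \in U ->
  c \in Y -> w a c = 1 -> c \in U \/ a \in perp U ->
  g \in perp A -> g + c \in perp U ->
  (forall Y' A' U', (\dim Y' < \dim Y)%N -> isotropic_data Y' A' U' ->
     exists s', adapted Y' s' [:: A'; U']) ->
  exists s', adapted Y s' [:: A; U].
Proof.
move=> data rE + aA uU cY ac cU gA gcU; rewrite memv_cap => /andP[rY /perpP rp].
have [AY AA UY] := data; have aY := subvP AY a aA.
have ra : w r a = 0 by exact: rp.
have rc : w r c = 0 by exact: rp.
have ar : w a r = 0 by rewrite wC ra oppr0.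
have cr : w c r = 0 by rewrite wC rc oppr0.
have ca : w c a = -1 by rewrite wC ac.
have ag : w a g = 0 by rewrite wC (perpP _ _ gA) ?oppr0.
have xgc x : x \in U -> w x g = - w x c.
  move=> xU; have := perpP _ _ gcU x xU; rewrite wC wDr => /eqP.
  by rewrite oppr_eq0 addr_eq0 => /eqP.
have rg : w r g = 1.
  rewrite rE wDl ag add0r xgc //; move/eqP: rc.
  by rewrite {1}rE wDl ac addrC addr_eq0 => /eqP ->; rewrite opprK.
pose s := [:: a; c; r].
have ms v : v \in s -> v \in signed_sums s by exact: signed_sums_mem.
have us : - a + r \in signed_sums s.
  apply: (@signed_sums_cat _ _ [:: a] [:: c; r]); first exact/signed_sums_memN/mem_head.
  by apply: signed_sums_mem; rewrite !inE eqxx orbT.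
have uE : - a + r = u by rewrite rE addKr.
(* the projection onto the span of s along Y'; the coefficient of r makes
   x - p x orthogonal to g *)
pose p x := w x c *: a - w x a *: c + (w x g + w x a * w c g) *: r.
pose Y' := (Y :&: perp <<[:: a; c; g]>>)%VS.
have pY' x : x \in Y -> x - p x \in Y'.
  move=> xY; rewrite memv_cap; apply/andP; split.
    by rewrite memvB // /p memvD ?memvB ?memvZ.
  rewrite perp_span /= !wE ac ca ag ra rc rg.
  by apply/and4P; split=> //; apply/eqP; ring.
apply: (@adapted_step_isotropic _ Y' _ _ s) => //; last 1 first.
- move=> X; rewrite !inE => /or3P[]/eqP->; apply: (@split_by _ _ _ p) => x xX;
    split; try (by apply: pY'; move: x xX; apply/subvP; rewrite ?subvv).
  + rewrite /p; apply: memvD; first apply: memvB;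
      (apply: hull_scale; [by apply: ms; rewrite !inE eqxx ?orbT|by right]).
  + have /perpP xp := subvP AA x xX; have xa : w x a = 0 by exact: xp.
    have xg : w x g = 0 by rewrite wC (perpP _ _ gA) ?oppr0.
    rewrite /p xa xg mul0r addr0 !scale0r subr0 addr0.
    by apply: hull_scale; [apply: ms; rewrite mem_head|right].
  have -> : p x = - (w x a *: c) - w x c *: (- a + r).
    have h : w x a * w c g = 0.
      case: cU => [cU|/perpP h]; last by rewrite wC h // oppr0 mul0r.
      by rewrite xgc // w_alt oppr0 mulr0.
    rewrite /p h xgc // addr0 scaleNr scalerDr scalerN opprD opprK.
    by rewrite [w x c *: a - _]addrC addrA.
  rewrite memvB ?memvN //; last by apply: hull_scale => //; rewrite uE; right.
  apply: hull_scale; first by rewrite ms ?inE ?eqxx ?orbT.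
  by case: cU => [|/perpP h]; [right|left; rewrite wC h ?oppr0].
- have -> : (\dim Y = \dim (Y :&: perp <<[::]>>))%N by rewrite span_nil orthov0 capvf.
  have h1 := @dim_cut Y r g [::] rY; have h2 := @dim_cut Y a c [:: g] aY.
  have vY : c - w c g *: r \in Y by rewrite memvB ?memvZ.
  have h3 := @dim_cut Y _ a [:: c; g] vY.
  move: h1 h2 h3; rewrite !perp_span /= rg ac ag !wE ca ra rc rg.
  rewrite mulr0 mulr1 !subrr subr0 oppr_eq0 oner_neq0 eqxx.
  move=> /(_ isT isT) h1 /(_ isT isT) h2 /(_ isT isT) h3.
  rewrite addn3; apply: leq_trans h1; rewrite ltnS; apply: leq_trans h2.
  by rewrite ltnS.
- move=> x y; rewrite !inE => /or3P[]/eqP-> /or3P[]/eqP->;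
  by rewrite ?w_alt ?ac ?ca ?ar ?ra ?cr ?rc eqxx ?orbT.
- apply/subvP => x; rewrite memv_cap !perp_span /= => /and5P[xY -> -> _ _].
  by rewrite wC rp ?oppr0 ?eqxx.
- exact: capvSl.
Qed.

(** An isotropic chain completed to a self-dual one. *)
Definition isotropic_hull Y Us : seq {vspace V} :=
  0%VS :: Y :: Us ++ [seq (Y :&: perp A)%VS | A <- Us].

Lemma self_dual_isotropic_hull Y Us :
  (Y :&: perp Y = 0)%VS -> {in Us, forall A, A <= Y}%VS ->
  {in Us, forall A, A <= perp A}%VS ->
  {in Us &, forall A B, (A <= B)%VS || (B <= A)%VS} ->
  self_dual_chain Y (isotropic_hull Y Us).
Proof.
move=> Y0 UsY iso tot.
have cmp A B : A \in Us -> B \in Us -> (A <= Y :&: perp B)%VS.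
  move=> As Bs; rewrite subv_cap UsY //=; case/orP: (tot A B As Bs) => AB.
    by rewrite (subv_trans AB) ?iso.
  by rewrite (subv_trans (iso A As)) ?perpS.
have mem X : X \in isotropic_hull Y Us ->
    [\/ X = 0%VS, X = Y, X \in Us | exists2 A, A \in Us & X = (Y :&: perp A)%VS].
  rewrite !inE mem_cat => /or4P[/eqP|/eqP||/mapP[A As ->]];
    [by constructor 1|by constructor 2|by constructor 3|constructor 4].
  by exists A.
split.
- by rewrite !inE eqxx orbT.
- by move=> X /mem[->|->|/UsY|[A _ ->]]; rewrite ?sub0v ?subvv ?capvSl.
- move=> X Z /mem[->|->|Xs|[A As ->]] /mem[->|->|Zs|[B Bs ->]];
    rewrite ?sub0v ?subvv ?capvSl ?orbT //.
  + by rewrite UsY // orbT.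
  + by rewrite UsY.
  + exact: tot.
  + by rewrite cmp.
  + by rewrite cmp ?orbT.
  by case/orP: (tot A B As Bs) => /perpS AB; rewrite (capvS (subvv Y) AB) ?orbT.
move=> X /mem[->|->|Xs|[A As ->]].
- by rewrite orthov0 capvf !inE eqxx orbT.
- by rewrite Y0 inE eqxx.
- by rewrite !inE mem_cat (map_f (fun A => Y :&: perp A)%VS) ?orbT.
have -> : (Y :&: perp (Y :&: perp A))%VS = A; last by rewrite !inE mem_cat As !orbT.
apply/eqP; rewrite eqEsubv subv_cap UsY //= -{3}[A]perpK perpS ?capvSr // andbT.
apply/subvP => x; rewrite memv_cap => /andP[xY xp].
exact: (mem_perpK_in Y0 (UsY A As)).
Qed.

(** If the radical [R] is zero the previous part applies. Otherwise a single
vector of [R] splits off when some nonzero vector of [R] lies in [A], in [U] or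
outside [A + U]; if there is none, a decomposition [r = a + u] of a nonzero
vector of [R] gives a triple. *)
Theorem adapted_isotropic Y A U :
  isotropic_data Y A U -> exists s, adapted Y s [:: A; U].
Proof.
have [n] := ubnP (\dim Y); elim: n Y A U => // n IHn Y A U ltYn data.
have IH Y' A' U' : (\dim Y' < \dim Y)%N -> isotropic_data Y' A' U' ->
    exists s', adapted Y' s' [:: A'; U'].
  by move=> lt; apply: IHn; apply: leq_trans lt ltYn.
have [AY AA UY] := data; set R := (Y :&: perp Y)%VS.
have [R0|Rn0] := eqVneq R 0%VS.
  have [s ads] : exists s, adapted Y s (U :: isotropic_hull Y [:: A]).
    apply: adapted_self_dual_chain; split=> //; apply: self_dual_isotropic_hull => //.
    - by move=> X; rewrite inE => /eqP ->.
    - by move=> X; rewrite inE => /eqP ->.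
    by move=> X Z; rewrite !inE => /eqP -> /eqP ->; rewrite subvv.
  by exists s; apply: adapted_sub ads => X; rewrite !inE => /orP[]->; rewrite ?orbT.
have one_dim r : r \in R -> r != 0 -> [\/ r \in A, r \in U | r \notin (A + U)%VS] ->
    exists s, adapted Y s [:: A; U].
  move=> rR rn0 hr.
  have [g + rg] : exists2 g, g \in perp ((if r \in A then 0 else A) +
      (if r \in U then 0 else U))%VS & w r g = 1.
    apply: sep; case: ifP hr => rA; case: ifP => rU;
      rewrite ?add0v ?addv0 ?memv0 ?rU ?rA //.
    by case.
  rewrite mem_perpD => /andP[gA gU]; apply: (split_off_radical data rR rg) => //.
    by move: gA; case: ifP; [left|right].
  by move: gU; case: ifP; [left|right].
have [RA|RAn0] := eqVneq (R :&: A)%VS 0%VS; last first.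
  have := memv_pick (R :&: A); rewrite memv_cap => /andP[rR rA].
  by apply: (one_dim _ rR); rewrite ?vpick0 //; constructor 1.
have [RU|RUn0] := eqVneq (R :&: U)%VS 0%VS; last first.
  have := memv_pick (R :&: U); rewrite memv_cap => /andP[rR rU].
  by apply: (one_dim _ rR); rewrite ?vpick0 //; constructor 2.
pose r := vpick R; have rR : r \in R := memv_pick R.
have rn0 : r != 0 by rewrite vpick0.
have [rAU|rAU] := boolP (r \in (A + U)%VS); last first.
  by apply: (one_dim r) => //; constructor 3.
have {rAU}[a [u [c [rE aA uU cY [ac cZ cU]]]]] :
    exists a u c, [/\ r = a + u, a \in A, u \in U, c \in Y &
      [/\ w a c = 1, c \in perp (A :&: U)%VS & c \in U \/ a \in perp U]].
  have /memv_addP[a0 a0A [u0 u0U rE]] := rAU.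
  (* a0 may be changed by a vector z of both A and U; if some z makes it
     orthogonal to U, then c need only be in Y, otherwise c exists in U *)
  have [/memv_addP[q qU [z zAU a0E]]|a0n] :=
    boolP (a0 \in (perp U + A :&: U)%VS); last first.
    have [c [cU cZ ac]] := sep_cap a0n.
    by exists a0, u0, c; split => //; [apply: subvP cU|split=> //; left].
  move: zAU; rewrite memv_cap => /andP[zA zU].
  have qE : q = a0 - z by rewrite a0E addrK.
  have qA : q \in A by rewrite qE memvB.
  have [c [cY cZ qc]] : exists c, [/\ c \in Y, c \in perp (A :&: U)%VS & w q c = 1].
    apply: sep_cap; apply/negP => /memv_addP[y yY [t + qE']].
    rewrite memv_cap => /andP[tA tU].
    (* here r - y would be in R and in U, so r = y = q - t would be in A *)
    have yR : y \in R.
      by rewrite memv_cap yY andbT -[y](addrK t) -qE' memvB // (subvP AY).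
    have : r - y \in (R :&: U)%VS.
      rewrite memv_cap memvB //= rE a0E qE'.
      have -> : y + t + z + u0 - y = t + z + u0 by rewrite [LHS]addrC -!addrA addKr.
      by rewrite !memvD.
    rewrite RU memv0 subr_eq0 => /eqP ry.
    have : r \in (R :&: A)%VS.
      by rewrite memv_cap rR ry -[y](addrK t) -qE' memvB.
    by rewrite RA memv0 (negPf rn0).
  exists q, (u0 + z), c; split => //; [|exact: memvD|by split=> //; right].
  by rewrite rE a0E -addrA [z + _]addrC.
have := cZ; rewrite perp_cap => /memv_addP[c1 c1A [c2 c2U cE]].
apply: (@split_off_triple _ _ _ r a u c (- c1)) => //.
  by rewrite memvN.
by rewrite cE addKr.
Qed.

(** * A Witt theorem relative to a Lagrangian subspace *)

Lemma extend_one phi U v v' : v \notin U -> isometric_on U phi ->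
  {in U, forall u, w (phi u) v' = w u v} ->
  exists psi, [/\ {in U, psi =1 phi}, psi v = v' & isometric_on (U + <[v]>) psi].
Proof.
move=> vU iso hv'; have [g gU vg] := sep vU.
pose f x := w x g *: (v' - phi v).
have lin_f : linear f by move=> k x y; rewrite /f wDl wZl scalerDl scalerA.
pose fL : {linear V -> V} := HB.pack f (GRing.isLinear.Build _ _ _ _ f lin_f).
pose psi := (phi + linfun fL)%VF.
have psiE x : psi x = phi x + w x g *: (v' - phi v) by rewrite add_lfunE lfunE.
have psiU : {in U, psi =1 phi}.
  by move=> x xU; rewrite psiE wC (perpP _ _ gU) // oppr0 scale0r addr0.
have psiv : psi v = v' by rewrite psiE vg scale1r addrC subrK.
exists psi; split=> // x y /memv_addP[u uU [_ /vlineP[k ->] ->]].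
move=> /memv_addP[z zU [_ /vlineP[m ->] ->]].
have h : w v' (phi z) = w v z by rewrite wC hv' // -wC.
by rewrite !linearD !linearZ /= psiv !psiU // !wE iso // hv' // h.
Qed.

(** The linear form [w _ v] transported along an injective map is represented by
some vector. *)
Lemma adjoint_vector phi U v : {in U, forall x, phi x = 0 -> x = 0} ->
  exists v', {in U, forall u, w (phi u) v' = w u v}.
Proof.
move=> inj; have k0 : (U :&: lker phi = 0)%VS.
  apply/eqP; rewrite -subv0; apply/subvP => x; rewrite memv_cap memv_ker memv0.
  by move=> /andP[xU /eqP /inj ->].
have bphi := limg_basis_of k0 (vbasisP U).
have [f hf] := linear_of_free (map phi (vbasis U)) (vbasis U).
have {}hf := hf (basis_free bphi) (esym (size_map _ _)).
pose l y : F^o := w (f y) v.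
have lin_l : linear l by move=> k x y; rewrite /l linearP wDl wZl.
pose lL : {linear V -> F^o} := HB.pack l (GRing.isLinear.Build _ _ _ _ l lin_l).
have [v' hv'] := riesz lL.
exists v' => u uU; rewrite hv' /= /l; congr (w _ v).
rewrite {1}(coord_vbasis uU) [in RHS](coord_vbasis uU) !linear_sum; apply: eq_bigr => i _.
rewrite !linearZ /=; congr (_ *: _).
have := congr1 (fun q : seq V => q`_i) hf.
by rewrite -map_comp (nth_map 0) // size_tuple.
Qed.

(** The isometry is extended one vector [v] at a time. As long as [L] is not
contained in [U], take [v] in [L]: the prescribed products with the image of
[U] are compatible with an image of [v] in [L'], since [phi] maps [U :&: L] onto
the intersection of the image with [L']. That image can moreover be chosen
outside the image of [U], because [L :&: perp U] and its counterpart for [L']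
have the same dimension. Once [L <= U], any [v] outside [U] will do: an image
inside that of [U] would force [v - u] into [perp U <= perp L = L] for some [u]
in [U]. *)
Theorem witt_lagrangian phi U L L' : perp L = L -> perp L' = L' ->
  isometric_on U phi -> {in U, forall x, phi x = 0 -> x = 0} ->
  {in U, forall x, (phi x \in L') = (x \in L)} ->
  exists psi, [/\ {in U, psi =1 phi}, forall x y, w (psi x) (psi y) = w x y &
    forall x, (psi x \in L') = (x \in L)].
Proof.
move=> LL LL'; have [n] := ubnP (\dim {:V} - \dim U)%N.
elim: n U phi => // n IHn U phi ltn iso inj phiL.
have [Uf|Uf] := boolP ({:V} <= U)%VS.
  have inU x : x \in U by apply: (subvP Uf); rewrite memvf.
  by exists phi; split=> // x *; [apply: iso|apply: phiL].
have dimU : (\dim U < \dim {:V})%N.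
  by rewrite ltn_neqAle dimvS ?subvf // andbT (dimv_leqif_sup (subvf U)).
suff [v [v' [vU v'U hv' hL]]] : exists v v', [/\ v \notin U, v' \notin (phi @: U)%VS,
    {in U, forall u, w (phi u) v' = w u v} &
    {in U, forall u k, (phi u + k *: v' \in L') = (u + k *: v \in L)}].
  have [psi [psiU psiv iso']] := extend_one vU iso hv'.
  have psiE u k : u \in U -> psi (u + k *: v) = phi u + k *: v'.
    by move=> uU; rewrite linearD linearZ /= psiU // psiv.
  have [||||psi' [h1 h2 h3]] := IHn (U + <[v]>)%VS psi.
  - apply: leq_trans (_ : _ < \dim {:V} - \dim U)%N _; last by [].
    apply: ltn_sub2l => //; rewrite ltn_neqAle dimvS ?addvSl // andbT.
    rewrite (dimv_leqif_sup (addvSl _ _)); apply: contra vU => /subvP; apply.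
    by rewrite (subvP (addvSr _ _)) // memv_line.
  - exact: iso'.
  - move=> _ /memv_addP[u uU [_ /vlineP[k ->] ->]]; rewrite psiE // => /eqP.
    have [->|k0] := eqVneq k 0; first by rewrite !scale0r !addr0 => /eqP /inj ->.
    rewrite addr_eq0 => /eqP uE; case/negP: v'U.
    rewrite -[v'](scalerK k0) memvZ // -[k *: v']opprK -uE memvN.
    exact: memv_img.
  - by move=> _ /memv_addP[u uU [_ /vlineP[k ->] ->]]; rewrite psiE // hL.
  exists psi'; split=> // x xU; rewrite h1 ?psiU //.
  exact: subvP (addvSl _ _) _ xU.
have inj_cap X : (X <= U)%VS -> (X :&: lker phi = 0)%VS.
  move=> XU; apply/eqP; rewrite -subv0; apply/subvP => x; rewrite memv_cap memv_ker memv0.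
  by move=> /andP[/(subvP XU) xU /eqP /inj ->].
have imgL : (phi @: (U :&: L) = phi @: U :&: L')%VS.
  apply/vspaceP => y; apply/memv_imgP/idP.
    move=> [x]; rewrite memv_cap => /andP[xU xL ->].
    by rewrite memv_cap memv_img //= phiL.
  rewrite memv_cap => /andP[/memv_imgP[x xU ->]]; rewrite phiL // => xL.
  by exists x; rewrite // memv_cap xU.
have dimL : \dim L = \dim L'.
  have := dim_perp L; rewrite -(dim_perp L') LL LL' !addnn => h.
  exact: double_inj.
have [LU|/subvPn[v vL vU]] := boolP (L <= U)%VS.
  have [v _ vU] := subvPn Uf; have [v' hv'] := adjoint_vector v inj.
  exists v, v'.
  have L'U : (L' <= phi @: U)%VS.
    apply/capv_idPr; apply/eqP; rewrite eqEdim capvSr -imgL.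
    by rewrite /= limg_dim_eq ?inj_cap ?capvSl // (capv_idPr LU) dimL leqnn.
  have v'U : v' \notin (phi @: U)%VS.
    apply: contra vU => /memv_imgP[u uU v'E].
    have vuU : v - u \in perp U.
      apply/perpP => x xU.
      by rewrite wC wDr wNr -(hv' x) // -(iso x u) // -v'E subrr oppr0.
    rewrite -[v](subrK u) memvD // (subvP LU) //.
    by rewrite -LL; apply: subvP (perpS LU) _ vuU.
  split=> // u uU k; have [->|k0] := eqVneq k 0; first by rewrite !scale0r !addr0 phiL.
  have nin X y z : y \in X -> z \notin X -> y + k *: z \notin X.
    move=> yX; apply: contra => yzX; rewrite -[z](scalerK k0) memvZ //.
    by rewrite -[k *: z](addKr y) memvD // memvN.
  rewrite [RHS](contraNF (subvP LU _)) ?nin //.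
  by rewrite (contraNF (subvP L'U _)) // nin ?memv_img.
have [v0 hv0] := adjoint_vector v inj.
have [z [zU [l lL' v0E]]] : exists z,
    z \in perp (phi @: U)%VS /\ exists2 l, l \in L' & v0 = z + l.
  have : v0 \in perp (phi @: U :&: L')%VS.
    rewrite -imgL; apply/perpP => _ /memv_imgP[x + ->]; rewrite memv_cap => /andP[xU xL].
    have /perpP xp : x \in perp L by rewrite LL.
    by rewrite wC hv0 // xp ?oppr0.
  by rewrite perp_cap LL' => /memv_addP[z zU [l lL' ->]]; exists z; split=> //; exists l.
have hl : {in U, forall u, w (phi u) l = w u v}.
  move=> u uU; rewrite -hv0 // v0E wDr [w _ z]wC (perpP _ _ zU) ?oppr0 ?add0r //.
  exact: memv_img.
have conclude v' : v' \in L' -> v' \notin (phi @: U)%VS ->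
    {in U, forall u, w (phi u) v' = w u v} ->
    exists v v', [/\ v \notin U, v' \notin (phi @: U)%VS,
      {in U, forall u, w (phi u) v' = w u v} &
      {in U, forall u k, (phi u + k *: v' \in L') = (u + k *: v \in L)}].
  move=> v'L' v'U hv'; exists v, v'; split=> // u uU k.
  by rewrite !rpredDr ?memvZ // phiL.
have [/memv_imgP[u0 u0U lE]|lU] := boolP (l \in (phi @: U)%VS); last exact: (conclude l).
have vu0 : v - u0 \in (L :&: perp U)%VS.
  rewrite memv_cap memvB //=; last by rewrite -phiL // -lE.
  by apply/perpP => x xU; rewrite wC wDr wNr -(hl x) // -(iso x u0) // -lE subrr oppr0.
(* l is in the image of U, so it has to be moved by a vector t of L' that is
   orthogonal to the image of U and not in it *)
have dimK : \dim (L :&: perp U) = \dim (L' :&: perp (phi @: U)).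
  have aux X Z : perp X = X -> (\dim (X :&: perp Z) + \dim X + \dim Z =
      \dim {:V} + \dim (Z :&: X))%N.
    move=> XX; have <- : perp (Z + X) = (X :&: perp Z)%VS.
      by apply/vspaceP => x; rewrite mem_perpD memv_cap XX andbC.
    rewrite -(dim_perp (Z + X)) -addnA [(\dim X + _)%N]addnC -dimv_sum_cap.
    by rewrite addnA [X in (X + _)%N]addnC.
  have e1 := aux L U LL; have := aux L' (phi @: U)%VS LL'.
  rewrite -imgL -dimL !limg_dim_eq ?inj_cap ?capvSl // -e1 => /addIn /addIn.
  by move->.
have [K'U|/subvPn[t]] := boolP (L' :&: perp (phi @: U) <= phi @: U)%VS; last first.
  rewrite memv_cap => /andP[tL' tp] tU; apply: (conclude (l + t)).
  - exact: memvD.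
  - apply: contra tU => ltU; rewrite -[t](addKr l) memvD // memvN lE.
    exact: memv_img.
  move=> u uU; rewrite wDr hl // [w _ t]wC (perpP _ _ tp) ?oppr0 ?addr0 //.
  exact: memv_img.
case/negP: vU; rewrite -[v](subrK u0) memvD //.
have KU : ((L :&: perp U) :&: U)%VS = (L :&: perp U)%VS.
  apply/eqP; rewrite eqEdim capvSl /= dimK.
  rewrite -(limg_dim_eq (inj_cap _ (capvSr _ U))) dimvS //.
  apply/subvP => y yK; have /memv_imgP[u uU yE] := subvP K'U y yK.
  move: yK; rewrite yE memv_cap phiL // => /andP[uL up].
  apply: memv_img; rewrite !memv_cap uL uU andbT /=.
  by apply/perpP => x xU; rewrite -iso // (perpP _ _ up) ?memv_img.
by move: vu0; rewrite -KU memv_cap => /andP[].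
Qed.

(** * Finiteness of the set of normal forms *)

Let N : nat := \dim {:V}.

(** The pair of booleans tells apart the values 0, 1 and -1; indices beyond the
size of [s] are harmless, the default being the zero vector. *)
Definition gram_code s : {ffun 'I_N * 'I_N -> bool * bool} :=
  [ffun ij : 'I_N * 'I_N => (w s`_ij.1 s`_ij.2 == 1, w s`_ij.1 s`_ij.2 == -1)].

Definition mask_code s U : {ffun 'I_(3 ^ N) -> bool} :=
  [ffun k : 'I_(3 ^ N) => nth false (in_mask s U) k].

Lemma small_code_inj (x y : F) : x \in [:: 0; 1; -1] -> y \in [:: 0; 1; -1] ->
  (x == 1, x == -1) = (y == 1, y == -1) -> x = y.
Proof.
rewrite !inE => hx hy [h1 h2].
have [x1|x1] := eqVneq x 1; first by apply/esym/eqP; rewrite x1 -h1 x1.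
have [x2|x2] := eqVneq x (-1); first by apply/esym/eqP; rewrite x2 -h2 x2.
move: hx hy; rewrite -h1 -h2 (negbTE x1) (negbTE x2) !orbF.
by move=> /eqP -> /eqP ->.
Qed.

Lemma mask_code_inj s s' U U' : size s = size s' -> (size s <= N)%N ->
  mask_code s U = mask_code s' U' -> in_mask s U = in_mask s' U'.
Proof.
move=> ss sN /ffunP h; have sz t X : size (in_mask t X) = (3 ^ size t)%N.
  by rewrite size_map size_signed_sums.
apply: (@eq_from_nth _ false) => [|k]; rewrite !sz ?ss // => ltk.
have ltkN : (k < 3 ^ N)%N by rewrite (leq_trans ltk) // leq_exp2l // -ss.
by move: (h (Ordinal ltkN)); rewrite !ffunE.
Qed.

Lemma adapted_transport Y Y' s s' Us Us' :
  adapted Y s Us -> adapted Y' s' Us' -> size s = size s' ->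
  gram_code s = gram_code s' ->
  exists phi, [/\ isometric_on Y phi, (phi @: Y)%VS = Y' &
    forall U U', U \in Us -> U' \in Us' -> mask_code s U = mask_code s' U' ->
      (phi @: U)%VS = U'].
Proof.
move=> [bs gs hs] [bs' gs' hs'] ss /ffunP gc.
have sN : (size s <= N)%N.
  by rewrite -(size_basis (X := in_tuple s) bs) dimvS ?subvf.
have [|phi [iso phiY phiU]] := transport bs bs' ss.
  move=> i j lti ltj; have := gc (Ordinal (leq_trans lti sN), Ordinal (leq_trans ltj sN)).
  rewrite !ffunE /=; apply: small_code_inj; first by apply: gs; apply: mem_nth.
  by apply: gs'; apply: mem_nth; rewrite -ss.
exists phi; split=> // U U' Us_U Us_U' hm; apply: phiU; [exact: hs|exact: hs'|].
exact: mask_code_inj hm.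
Qed.

End Alternating.

(** * Cosets, flags and orbits *)

Section Matrices.
Variables (F : fieldType) (m : nat).
Implicit Types (g h k q : 'M[F]_m) (H : set 'M[F]_m) (D : set nat).
Implicit Types (U : {vspace 'cV[F]_m}) (E : nat -> {vspace 'cV[F]_m}).

Definition act g U := (linfun (mulmx g) @: U)%VS.

Lemma act1 U : act 1%:M U = U.
Proof.
rewrite /act -[RHS]lim1g; apply: eq_in_limg => x _.
by rewrite lfunE id_lfunE /= mul1mx.
Qed.

Lemma actM g h U : act (g *m h) U = act g (act h U).
Proof.
rewrite /act -limg_comp; apply: eq_in_limg => x _.
by rewrite comp_lfunE !lfunE /= mulmxA.
Qed.

Lemma actS g U U' : (U <= U')%VS -> (act g U <= act g U')%VS.
Proof. exact: limgS. Qed.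

Lemma actK g U : g \in unitmx -> act (invmx g) (act g U) = U.
Proof. by move=> gu; rewrite -actM mulVmx // act1. Qed.

Lemma dim_act g U : g \in unitmx -> \dim (act g U) = \dim U.
Proof.
move=> gu; apply: limg_dim_eq; apply/eqP; rewrite -subv0; apply/subvP => x.
rewrite memv_cap memv_ker memv0 lfunE /= => /andP[_ /eqP gx].
by rewrite -[x]mul1mx -(mulVmx gu) -mulmxA gx mulmx0.
Qed.

Definition is_subgroup H :=
  [/\ {in H, forall g, g \in unitmx}, forall g h, H g -> H h -> H (g *m h) &
      forall g, H g -> H (invmx g)].

Lemma mulmx_inj_fun (g h : 'M[F]_m) : (forall v : 'cV_m, g *m v = h *m v) -> g = h.
Proof.
by move=> gh; apply/matrixP => i j; have := gh (delta_mx j 0);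
  rewrite -!colE => /colP/(_ i); rewrite !mxE.
Qed.

Lemma matrix_of_lfun (phi : 'End('cV[F]_m)) : exists g, forall v, g *m v = phi v.
Proof.
exists (\matrix_(i, j) phi (delta_mx j 0) i 0) => v; apply/colP => i; rewrite mxE.
rewrite [in RHS](matrix_sum_delta v) linear_sum summxE; apply: eq_bigr => j _.
by rewrite big_ord1 linearZ /= !mxE mulrC.
Qed.

Lemma left_cosetM g h H : left_coset g (left_coset h H) = left_coset (g *m h) H.
Proof.
apply/seteqP; split => x.
  by move=> [_ [y Hy <-] <-]; exists y => //; rewrite mulmxA.
by move=> [y Hy <-]; exists (h *m y); [exists y|rewrite mulmxA].
Qed.

End Matrices.
Section Orbits.
Variables (F : fieldType) (m : nat).
Implicit Types (g h k q : 'M[F]_m) (H : set 'M[F]_m) (D : set nat).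
Implicit Types (U : {vspace 'cV[F]_m}) (E : nat -> {vspace 'cV[F]_m}).

Lemma is_subgroup_GL : is_subgroup (GL F m).
Proof.
by split=> [g|g h gu hu|g gu]; rewrite ?inE // /GL /= ?unitmx_mul ?unitmx_inv ?gu.
Qed.

Lemma is_subgroup_Sp (w : {skew_symmetric 'cV[F]_m}) : is_subgroup (Sp w).
Proof.
split=> [g|g h [gu giso] [hu hiso]|g [gu giso]]; first by rewrite inE => -[].
  by split; [rewrite unitmx_mul gu|move=> x y; rewrite -!mulmxA giso hiso].
by split; [rewrite unitmx_inv|move=> x y; rewrite -giso !mulmxA mulmxV ?mul1mx].
Qed.

Lemma is_subgroup_stabilizer H D E : is_subgroup H -> is_subgroup (flag_stabilizer H D E).
Proof.
move=> [Hu HM HV]; split=> [g|g h [Hg gE] [Hh hE]|g [Hg gE]].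
- by rewrite inE => -[Hg _]; apply: Hu; rewrite inE.
- by split=> [|i Di]; [exact: HM|rewrite -/(act _ _) actM /act hE ?gE].
split=> [|i Di]; first exact: HV.
by rewrite -/(act _ _) -{1}(gE i Di) -/(act _ _) actK ?Hu ?inE.
Qed.

Lemma left_coset_absorb g q H : is_subgroup H -> H q ->
  left_coset (g *m q) H = left_coset g H.
Proof.
move=> [Hu HM HV] Hq; have qu : q \in unitmx by apply: Hu; rewrite inE.
rewrite -left_cosetM; congr left_coset; apply/seteqP; split => x.
  by move=> [y Hy <-]; exact: HM.
move=> Hx; exists (invmx q *m x); first by apply: HM => //; exact: HV.
by rewrite mulmxA mulmxV ?mul1mx.
Qed.

(** An element that carries the flag of one coset to that of another carries the
first coset to the second. *)
Lemma left_coset_stabilizer g g' h H D E : is_subgroup H -> H (h *m g) -> H g' ->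
  (forall i, D i -> act h (act g (E i)) = act g' (E i)) ->
  left_coset h (left_coset g (flag_stabilizer H D E)) =
  left_coset g' (flag_stabilizer H D E).
Proof.
move=> sH Hhg Hg' hE; have [Hu HM HV] := sH.
have g'u : g' \in unitmx by apply: Hu; rewrite inE.
rewrite left_cosetM -(mulKVmx g'u (h *m g)) left_coset_absorb //.
  exact: is_subgroup_stabilizer.
split=> [|i Di]; first by apply: HM => //; exact: HV.
by rewrite -/(act _ _) !actM hE // actK.
Qed.

(** Orbits are counted by a finite set of codes: if two configurations that share
a code are conjugate under [K], each orbit is determined by any of its codes. *)
Lemma finitely_many_orbits_by_code (Code : finType) (K : set 'M[F]_m) (S T : set nat) E L
    (code : 'M[F]_m -> 'M[F]_m -> Code -> Prop) :
  is_subgroup K ->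
  (forall k g, K k -> g \in unitmx -> exists c, code k g c) ->
  (forall k g k' g' c, K k -> K k' -> g \in unitmx -> g' \in unitmx ->
     code k g c -> code k' g' c -> exists h, [/\ K h,
       forall j, T j -> act h (act k (L j)) = act k' (L j) &
       forall i, S i -> act h (act g (E i)) = act g' (E i)]) ->
  finitely_many_orbits K (double_flag_variety (GL F m) K
    (flag_stabilizer (GL F m) S E) (flag_stabilizer K T L)).
Proof.
move=> sK code_ex code_eq; have [Ku KM KV] := sK.
set P := flag_stabilizer _ _ _; set Q := flag_stabilizer _ _ _.
pose pt k g := (left_coset k Q, left_coset g P).
pose orb c : set (set 'M[F]_m * set 'M[F]_m) :=
  xget set0 [set diag_orbit K (pt kg.1 kg.2) | kg in
     [set kg | [/\ K kg.1, kg.2 \in unitmx & code kg.1 kg.2 c]]].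
apply: (@sub_finite_set _ _ (orb @` [set: Code])); last first.
  exact/finite_image/finite_finset.
move=> _ [[a b] [[k Kk aE] [g gu bE]] <-]; rewrite /= in aE bE; rewrite -aE -bE.
have [c hc] := code_ex k g Kk gu; exists c => //; rewrite /orb.
case: xgetP => [O _ [[k' g'] /= [Kk' gu' hc'] <-]|]; last first.
  by move=> /(_ (diag_orbit K (pt k g)))[]; exists (k, g).
have [h [Kh hL hE]] := code_eq k' g' k g c Kk' Kk gu' gu hc' hc.
have hu : h \in unitmx by apply: Ku; rewrite inE.
have hQ : left_coset h (left_coset k' Q) = left_coset k Q.
  by apply: left_coset_stabilizer => //; exact: KM.
have hP : left_coset h (left_coset g' P) = left_coset g P.
  apply: left_coset_stabilizer => //; first exact: is_subgroup_GL.
  by rewrite /GL /= unitmx_mul hu.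
rewrite /diag_orbit /pt /= -hQ -hP; apply/seteqP; split => _ [x Kx <-] /=.
  exists (x *m invmx h); first by apply: KM => //; exact: KV.
  by rewrite !left_cosetM ?mulmxA mulmxKV.
by exists (x *m h); [exact: KM|rewrite !left_cosetM ?mulmxA].
Qed.

(** * The two cases *)

Section Symplectic.
Variable w : {skew_symmetric 'cV[F]_m}.
Hypotheses (w_alt : forall x, w x x = 0) (w_nondeg : nondegenerate w).
Local Notation perp := (orthov w).
Local Notation N := (\dim {:'cV[F]_m}).

Lemma Sp_of_isometry (phi : 'End('cV[F]_m)) :
  (forall x y, w (phi x) (phi y) = w x y) ->
  exists2 h, Sp w h & forall U, act h U = (phi @: U)%VS.
Proof.
move=> iso; have k0 : lker phi == 0%VS.
  rewrite -subv0 -(eqP w_nondeg); apply/subvP => x; rewrite memv_ker => /eqP px.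
  by apply/mem_orthovP => y _; rewrite -iso px (w0l w).
have [h hE] := matrix_of_lfun phi; have [h' hE'] := matrix_of_lfun phi^-1.
have h'h : h' *m h = 1%:M.
  by apply: mulmx_inj_fun => v; rewrite -mulmxA hE hE' lker0_lfunK // mul1mx.
exists h; first by split; [have [] := mulmx1_unit h'h|move=> x y; rewrite /= !hE iso].
by move=> U; apply: eq_in_limg => x _; rewrite lfunE /= hE.
Qed.

Lemma act_isotropic k U : Sp w k -> (U <= perp U)%VS -> (act k U <= perp (act k U))%VS.
Proof.
move=> [_ kiso] UU; apply/orthovP => _ _ /memv_imgP[x xU ->] /memv_imgP[y yU ->].
by rewrite !lfunE kiso; move/orthovP: UU; apply.
Qed.

Lemma isotropic_total T L k : Sp w k -> is_isotropic_flag w T L ->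
  forall s : seq nat, {in s, forall j, T j} ->
  {in [seq act k (L j) | j <- s], forall A, A <= perp A}%VS /\
  {in [seq act k (L j) | j <- s] &, forall A B, (A <= B)%VS || (B <= A)%VS}.
Proof.
move=> Kk [[_ Lle] Liso] s sT; split.
  by move=> _ /mapP[j js ->]; apply: act_isotropic => //; exact/Liso/sT.
move=> _ _ /mapP[j js ->] /mapP[j' js' ->].
case/orP: (leq_total j j') => jj'; apply/orP; [left|right]; apply: actS.
  by apply: Lle => //; exact: sT.
by apply: Lle => //; exact: sT.
Qed.

(** The chain is made of the members of the isotropic flag, their orthogonals,
the zero space and the full space. Besides the code of the one subspace, only
those of the isotropic members are recorded, as no other has to be matched. *)
Theorem finite_single_subspace (n i : nat) T E L :
  (forall j, T j -> (j <= n)%N) -> is_isotropic_flag w T L ->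
  finitely_many_orbits (Sp w) (double_flag_variety (GL F m) (Sp w)
    (flag_stabilizer (GL F m) [set i] E) (flag_stabilizer (Sp w) T L)).
Proof.
move=> Tn Lflag.
pose Ls k := [seq act k (L j) | j <- iota 0 n.+1 & `[< T j >]].
have LsP k j : T j -> act k (L j) \in Ls k.
  move=> Tj; apply: (map_f (fun j => act k (L j))).
  by rewrite mem_filter mem_iota /= add0n ltnS Tn // andbT; apply/asboolP.
pose code k g (c : {ffun 'I_N * 'I_N -> bool * bool} * {ffun 'I_(3 ^ N) -> bool} *
    {ffun 'I_n.+1 -> {ffun 'I_(3 ^ N) -> bool}}) :=
  exists2 s, adapted w fullv s (act g (E i) :: isotropic_hull w fullv (Ls k)) &
    c = (gram_code w s, mask_code s (act g (E i)),
         [ffun j : 'I_n.+1 => mask_code s (act k (L j))]).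
apply: (finitely_many_orbits_by_code (code := code)); first exact: is_subgroup_Sp.
  move=> k g Kk gu; have [h1 h2] : {in Ls k, forall A, A <= perp A}%VS /\
      {in Ls k &, forall A B, (A <= B)%VS || (B <= A)%VS}.
    by apply: (isotropic_total Kk Lflag) => j; rewrite mem_filter => /andP[/asboolP].
  have f0 : (fullv :&: perp fullv = 0)%VS by rewrite capfv; apply/eqP.
  have [|s ads] := @adapted_self_dual_chain _ _ w w_alt w_nondeg fullv
      (isotropic_hull w fullv (Ls k)) (act g (E i)).
    split; rewrite ?subvf //; apply: self_dual_isotropic_hull => // A _.
    exact: subvf.
  by eexists; exists s.
move=> k g k' g' c Kk Kk' gu gu' [s ads cE] [s' ads' cE'].
have ss : size s = size s'.
  have [bs _ _] := ads; have [bs' _ _] := ads'.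
  by rewrite -(size_basis (X := in_tuple s) bs) -(size_basis (X := in_tuple s') bs').
move: cE'; rewrite cE => -[gE mE LE].
have [phi [iso _ phiU]] := adapted_transport ads ads' ss gE.
have [|h Kh hE] := Sp_of_isometry (phi := phi).
  by move=> x y; apply: iso; exact: memvf.
exists h; split=> // [j Tj|_ ->]; rewrite hE; apply: phiU => //.
- by rewrite !inE mem_cat LsP ?orbT.
- by rewrite !inE mem_cat LsP ?orbT.
- by move/ffunP/(_ (Ordinal (Tn j Tj : (j < n.+1)%N))): LE; rewrite !ffunE.
- exact: mem_head.
- exact: mem_head.
Qed.

(** The code describes the larger subspace, its intersection with the Lagrangian
and the smaller subspace; equal codes give an isometry between the larger
subspaces, which then extends to the whole space. *)
Theorem finite_two_step (n i j : nat) E L : m = (2 * n)%N -> (i <= j)%N ->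
  is_flag [set i; j] E -> is_isotropic_flag w [set n] L ->
  finitely_many_orbits (Sp w) (double_flag_variety (GL F m) (Sp w)
    (flag_stabilizer (GL F m) [set i; j] E) (flag_stabilizer (Sp w) [set n] L)).
Proof.
move=> mE ij [_ Ele] [[dimL _] Liso].
have EE : (E i <= E j)%VS by apply: Ele => //=; [left|right].
have Lperp k : Sp w k -> perp (act k (L n)) = act k (L n).
  move=> Kk; have ku : k \in unitmx by case: Kk.
  apply/esym/eqP; rewrite eqEdim act_isotropic ?Liso //=.
  have := dim_perp w_nondeg (act k (L n)).
  rewrite dim_act // dimL // dimvf dim_matrix mulr1 => h.
  have : (n + \dim (perp (act k (L n))) <= 2 * n)%N by rewrite h -mE.
  by rewrite mul2n -addnn leq_add2l.
pose A k g := (act g (E j) :&: act k (L n))%VS.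
pose code k g (c : 'I_N.+1 * {ffun 'I_N * 'I_N -> bool * bool} *
    {ffun 'I_(3 ^ N) -> bool} * {ffun 'I_(3 ^ N) -> bool}) :=
  exists2 s, adapted w (act g (E j)) s [:: A k g; act g (E i)] &
    c = (inord (size s), gram_code w s, mask_code s (A k g), mask_code s (act g (E i))).
apply: (finitely_many_orbits_by_code (code := code)); first exact: is_subgroup_Sp.
  move=> k g Kk gu; have [|s ads] := @adapted_isotropic _ _ w w_alt w_nondeg
      (act g (E j)) (A k g) (act g (E i)).
    split; rewrite ?capvSl ?actS //.
    by rewrite (subv_trans (capvSr _ _)) // -{1}(Lperp k Kk) perpS // capvSr.
  by eexists; exists s.
move=> k g k' g' c Kk Kk' gu gu' [s ads cE] [s' ads' cE'].
have size_le t Y Us : adapted w Y t Us -> (size t < N.+1)%N.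
  by move=> [bt _ _]; rewrite ltnS -(size_basis (X := in_tuple t) bt) dimvS ?subvf.
move: cE'; rewrite cE => -[/(congr1 val) /= ss gE AE iE].
rewrite !inordK ?(size_le _ _ _ ads) ?(size_le _ _ _ ads') // in ss.
have [phi [iso phiY phiU]] := adapted_transport ads ads' ss gE.
have phiA : (phi @: A k g)%VS = A k' g' by apply: phiU; rewrite ?inE ?eqxx.
have phii : (phi @: act g (E i))%VS = act g' (E i).
  by apply: phiU; rewrite ?inE ?eqxx ?orbT.
have inj : {in act g (E j), forall x, phi x = 0 -> x = 0}.
  have := limg_ker_dim phi (act g (E j)); rewrite phiY !dim_act // -[RHS]add0n.
  move=> /addIn /eqP; rewrite dimv_eq0 => /eqP k0 x xE px; apply/eqP.
  by rewrite -memv0 -k0 memv_cap xE memv_ker px eqxx.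
have phiL : {in act g (E j), forall x, (phi x \in act k' (L n)) = (x \in act k (L n))}.
  move=> x xE; apply/idP/idP => xL.
    have : phi x \in (phi @: A k g)%VS by rewrite phiA memv_cap xL -phiY memv_img.
    move=> /memv_imgP[y]; rewrite memv_cap => /andP[yE yL] xy.
    have : x - y = 0.
      apply: inj; first exact: memvB.
      by apply/eqP; rewrite linearB subr_eq0; apply/eqP.
    by move/eqP; rewrite subr_eq0 => /eqP ->.
  have : phi x \in A k' g' by rewrite -phiA memv_img // memv_cap xE.
  by rewrite memv_cap => /andP[].
have [psi [psiU psi_iso psiL]] :=
  witt_lagrangian w_alt w_nondeg (Lperp k Kk) (Lperp k' Kk') iso inj phiL.
have [h Kh hE] := Sp_of_isometry psi_iso; have hu : h \in unitmx by case: Kh.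
have ku : k \in unitmx by case: Kk.
have ku' : k' \in unitmx by case: Kk'.
exists h; split=> // [_ ->|_ [->|->]].
- apply/eqP; rewrite eqEdim !dim_act // leqnn andbT hE.
  by apply/subvP => _ /memv_imgP[x xL ->]; rewrite psiL.
- rewrite hE -phii; apply: eq_in_limg => x xE; apply: psiU.
  exact: subvP (actS g EE) _ xE.
by rewrite hE -phiY; apply: eq_in_limg => x xE; apply: psiU.
Qed.

End Symplectic.
End Orbits.

Theorem mainTheorem6 (R : realType) (n : nat)
    (w : {skew_symmetric 'cV[R[i]]_(2 * n)}) (w_symp : is_psymplectic w)
    (S T : set nat)
    (S_sub : S `<=` [set i | (1 <= i <= 2 * n - 1)%N])
    (T_sub : T `<=` [set j | (1 <= j <= n)%N])
    (E L : nat -> {vspace 'cV[R[i]]_(2 * n)})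
    (E_flag : is_flag S E) (L_flag : is_isotropic_flag w T L) :
  let G := GL R[i] (2 * n) in
  let K := Sp w in
  let P := flag_stabilizer G S E in
  let Q := flag_stabilizer K T L in
  ((exists i : nat, S = [set i]) ->
     finitely_many_orbits K (double_flag_variety G K P Q)) /\
  ((exists i j : nat, S = [set i; j]) -> T = [set n] ->
     finitely_many_orbits K (double_flag_variety G K P Q)).
Proof.
have [w_nondeg _ _] := w_symp.
(* in characteristic 0 a skew-symmetric form is alternating *)
have w_alt x : w x x = 0.
  by apply/eqP; rewrite -Num.Theory.eqNr -(wC w) eqxx.
split=> [[i ->]|[i [j Sij]] Tn].
  by apply: (finite_single_subspace w_alt w_nondeg (n := n)) => // j /T_sub /= /andP[].
rewrite Tn in L_flag *; case/orP: (leq_total i j) => ij.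
  by rewrite Sij in E_flag *; apply: finite_two_step.
have Sji : S = [set j; i] by rewrite Sij setUC.
by rewrite Sji in E_flag *; apply: finite_two_step.
Qed.
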